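(* Let $n\ge 2$, $\lambda,\mu\in\mathbb{R}$ and $k\in\frac12\mathbb{N}$. There exists a $\mathcal{K}(n)$-invariant conjugation map $$*:\mathfrak{D}^{n,k}_{\lambda,\mu}\longrightarrow\mathfrak{D}^{n,k}_{\frac{2-n}{2}-\mu,\frac{2-n}{2}-\lambda},\qquad A\mapsto A^*,$$ defined by $$\langle A\varphi,\psi\rangle=(-1)^{|A||\varphi|}\langle\varphi,A^*\psi\rangle$$ for homogeneous $A\in\mathfrak{D}^{n,k}_{\lambda,\mu}$, $\varphi\in\mathfrak{F}^n_\lambda$ and all $\psi\in\mathfrak{F}^n_{\frac{2-n}{2}-\mu}$. Moreover, $*$ is a $\mathcal{K}(n)$-isomorphism, so that $\mathfrak{D}^{n,k}_{\lambda,\mu}\simeq\mathfrak{D}^{n,k}_{\frac{2-n}{2}-\mu,\frac{2-n}{2}-\lambda}$ for every $k\in\frac12\mathbb{N}$.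
   Context: $S^{1|n}$ is the supercircle with coordinates $(x,\theta_1,\dots,\theta_n)$, the $\theta_i$ odd and anticommuting; its smooth functions are $F=\sum f_{i_1,\dots,i_n}(x)\theta_1^{i_1}\cdots\theta_n^{i_n}$, $i_j\in\{0,1\}$, with $f_{i_1,\dots,i_n}\in C^\infty(S^1)$ (smooth real $2\pi$-periodic functions); $|\cdot|$ denotes parity and $'$ denotes $\frac{d}{dx}$. Put $\overline{\eta}_i=\partial_{\theta_i}-\theta_i\partial_x$, so $\overline{\eta}_i^2=-\partial_x$. The Lie superalgebra $\mathcal{K}(n)$ of contact vector fields (for the contact form $\alpha_n=dx+\sum_{i=1}^n\theta_id\theta_i$) is spanned by $X_F=F\partial_x-\frac12(-1)^{|F|}\sum_i\overline{\eta}_i(F)\overline{\eta}_i$, $F\in C^\infty(S^{1|n})$. The space of $\lambda$-densities is $\mathfrak{F}^n_\lambda=\{F\alpha_n^\lambda\mid F\in C^\infty(S^{1|n})\}$, a $\mathcal{K}(n)$-module via $\mathfrak{L}^\lambda_{X_F}(G\alpha_n^\lambda)=(X_F(G)+\lambda F'G)\alpha_n^\lambda$. For $k\in\frac12\mathbb{N}$, $\mathfrak{D}^{n,k}_{\lambda,\mu}$ is the space of differential operators $A:\mathfrak{F}^n_\lambda\to\mathfrak{F}^n_\mu$ of the form $A(F\alpha_n^\lambda)=\sum_{\ell_1+\cdots+\ell_n\le 2k}a_{\ell_1,\dots,\ell_n}\,\overline{\eta}_1^{\ell_1}\cdots\overline{\eta}_n^{\ell_n}(F)\,\alpha_n^\mu$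 with $\ell_i\in\mathbb{N}$, $a_{\ell_1,\dots,\ell_n}\in C^\infty(S^{1|n})$; it is a $\mathcal{K}(n)$-module for $X_F\cdot A=\mathfrak{L}^\mu_{X_F}\circ A-(-1)^{|A||F|}A\circ\mathfrak{L}^\lambda_{X_F}$. The Berezin integral $\mathcal{B}_n:\mathfrak{F}^n_{\frac{2-n}{2}}\to\mathbb{R}$ is $\mathcal{B}_n\left(\sum f_{i_1,\dots,i_n}(x)\theta_1^{i_1}\cdots\theta_n^{i_n}\alpha_n^{\frac{2-n}{2}}\right)=\int_{S^1}f_{1,\dots,1}\,dx$. For $\lambda+\mu=\frac{2-n}{2}$ the pairing $\langle\cdot,\cdot\rangle:\mathfrak{F}^n_\lambda\otimes\mathfrak{F}^n_\mu\to\mathbb{R}$ is $\langle F\alpha_n^\lambda,G\alpha_n^\mu\rangle=\mathcal{B}_n(FG\,\alpha_n^{\lambda+\mu})$. *)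

(* Defs.v *)
From HB Require Import structures.
From mathcomp Require Import all_boot all_order all_algebra.
From mathcomp Require Import all_classical all_reals all_analysis.

Set Implicit Arguments.
Unset Strict Implicit.
Unset Printing Implicit Defensive.

Import Order.TTheory GRing.Theory Num.Theory.
Import numFieldNormedType.Exports.

Local Open Scope classical_set_scope.
Local Open Scope ring_scope.

Section CircleFunctions.
Variable R : realType.

Definition smooth (f : R -> R) := forall m x, derivable (derive1n m f) x 1.

Definition circle_smooth : {pred R -> R} :=
  fun f => `[< periodic f (pi *+ 2) /\ smooth f >].

Record circle_fun := CircleFun {
  circle_val :> R -> R;
  _ : circle_val \in circle_smooth }.

HB.instance Definition _ := [isSub for circle_val].
HB.instance Definition _ := [Choice of circle_fun by <:].

Lemma circle_funP (f g : circle_fun) : (forall x, f x = g x) -> f = g.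
Proof. by move=> /funext fg; exact: val_inj. Qed.

Lemma circle_smoothP f :
  reflect (periodic f (pi *+ 2) /\ smooth f) (f \in circle_smooth).
Proof. exact: asboolP. Qed.

Implicit Types f g : R -> R.

Let Ck (m : nat) (f : R -> R) :=
  forall k, (k <= m)%N -> forall x, derivable (derive1n k f) x 1.

Lemma smooth_Ck f : smooth f <-> forall m, Ck m f.
Proof. by split=> [sf m k _|sf m x]; [exact: sf|exact: (sf m m)]. Qed.

Lemma CkS m f :
  Ck m.+1 f <-> (forall x, derivable f x 1) /\ Ck m (derive1 f).
Proof.
split=> [Cf|[df Cf] [|k] km x]; last 2 first.
- exact: df.
- by rewrite /derive1n iterSr; exact: Cf.
split=> [x|k km x]; first exact: (Cf 0%N).
by have := Cf k.+1 km x; rewrite /derive1n iterSr.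
Qed.

Lemma CkW m f : Ck m.+1 f -> Ck m f.
Proof. by move=> Cf k km; apply: Cf; exact: leqW. Qed.

Lemma Ck0 f : (forall x, derivable f x 1) -> Ck 0 f.
Proof. by move=> df [|//] _ x; exact: df. Qed.

Lemma CkD m f g : Ck m f -> Ck m g -> Ck m (f + g).
Proof.
elim: m f g => [|m IH] f g Cf Cg.
  by apply: Ck0 => x; apply: derivableD; [exact: (Cf 0%N)|exact: (Cg 0%N)].
have /CkS[df Cf'] := Cf; have /CkS[dg Cg'] := Cg.
apply/CkS; split=> [x|]; first exact: derivableD.
have -> : derive1 (f + g) = derive1 f + derive1 g.
  by apply/funext => y; rewrite derive1E deriveD// -!derive1E.
exact: IH.
Qed.

Lemma CkM m f g : Ck m f -> Ck m g -> Ck m (f * g).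
Proof.
elim: m f g => [|m IH] f g Cf Cg.
  by apply: Ck0 => x; apply: derivableM; [exact: (Cf 0%N)|exact: (Cg 0%N)].
have /CkS[df Cf'] := Cf; have /CkS[dg Cg'] := Cg.
apply/CkS; split=> [x|]; first exact: derivableM.
have -> : derive1 (f * g) = f * derive1 g + g * derive1 f.
  by apply/funext => y; rewrite derive1E deriveM// -!derive1E.
by apply: CkD; apply: IH => //; exact: CkW.
Qed.

Lemma smooth_deriv f : smooth f -> smooth (derive1 f).
Proof.
by move=> sf m x; have := sf m.+1 x; rewrite /derive1n iterSr.
Qed.

Lemma smooth_cst (c : R) : smooth (cst c).
Proof.
move=> m; elim: m c => [|m IH] c x; first exact: derivable_cst.
rewrite /derive1n iterSr.
suff -> : derive1 (cst c : R -> R) = cst 0 by exact: IH.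
by apply/funext => y; rewrite derive1_cst.
Qed.

Lemma smoothD f g : smooth f -> smooth g -> smooth (f + g).
Proof.
by move=> /smooth_Ck sf /smooth_Ck sg; apply/smooth_Ck => m; exact: CkD.
Qed.

Lemma smoothM f g : smooth f -> smooth g -> smooth (f * g).
Proof.
by move=> /smooth_Ck sf /smooth_Ck sg; apply/smooth_Ck => m; exact: CkM.
Qed.

Lemma circle_smooth_subring : subring_closed circle_smooth.
Proof.
split=> [|f g /circle_smoothP[pf sf] /circle_smoothP[pg sg]
         |f g /circle_smoothP[pf sf] /circle_smoothP[pg sg]];
    apply/circle_smoothP; split.
- by [].
- exact: smooth_cst.
- by move=> u; rewrite !fctE pf pg.
- apply: smoothD => //.
  have -> : - g = cst (- 1) * g by apply/funext => x; rewrite !fctE mulN1r.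
  by apply: smoothM => //; exact: smooth_cst.
- by move=> u; rewrite !fctE pf pg.
- exact: smoothM.
Qed.

HB.instance Definition _ :=
  GRing.SubChoice_isSubComPzRing.Build (R -> R) circle_smooth circle_fun
    circle_smooth_subring.

Lemma circle_cst_subproof (c : R) : (cst c : R -> R) \in circle_smooth.
Proof. by apply/circle_smoothP; split=> //; exact: smooth_cst. Qed.

Definition circle_cst (c : R) : circle_fun :=
  CircleFun (circle_cst_subproof c).

Definition circle_scale (c : R) (f : circle_fun) : circle_fun :=
  circle_cst c * f.

Fact circle_scaleA a b v :
  circle_scale a (circle_scale b v) = circle_scale (a * b) v.
Proof. by apply/circle_funP => x; rewrite /= !fctE /= mulrA. Qed.

Fact circle_scale1 : left_id 1 circle_scale.
Proof. by move=> v; apply/circle_funP => x; rewrite /= !fctE /= mul1r. Qed.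

Fact circle_scaleDr : right_distributive circle_scale +%R.
Proof. by move=> c u v; exact: mulrDr. Qed.

Fact circle_scaleDl v : {morph circle_scale^~ v : a b / a + b}.
Proof. by move=> a b; apply/circle_funP => x; rewrite /= !fctE /= mulrDl. Qed.

HB.instance Definition _ :=
  GRing.Zmodule_isLmodule.Build R circle_fun
    circle_scaleA circle_scale1 circle_scaleDr circle_scaleDl.

Lemma circle_scaleE (c : R) (f : circle_fun) : c *: f = circle_cst c * f.
Proof. by []. Qed.

Lemma circle_deriv_subproof (f : circle_fun) : derive1 f \in circle_smooth.
Proof.
case: f => f /= /circle_smoothP[pf sf].
apply/circle_smoothP; split; last exact: smooth_deriv.
by move=> x; rewrite /derive1 pf; under eq_fun do rewrite addrA pf.
Qed.

Definition circle_deriv (f : circle_fun) : circle_fun :=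
  CircleFun (circle_deriv_subproof f).

Definition circle_integral (f : circle_fun) : R :=
  \int[lebesgue_measure]_(x in `[0, pi *+ 2]) f x.

End CircleFunctions.

Section Supercircle.
Variables (R : realType) (n : nat).

(** [F I] is the coefficient of [\theta_i1 ... \theta_ip], where
    [I = {i1 < ... < ip}]. *)
Definition superfun := {ffun {set 'I_n} -> circle_fun R}.

HB.instance Definition _ := GRing.Lmodule.on superfun.

Implicit Types (F G : superfun) (i : 'I_n) (I J K : {set 'I_n}) (p : bool).

(** [\theta_I \theta_J = (-1)^(ninv I J) \theta_(I `|` J)] for disjoint
    [I] and [J]. *)
Definition ninv I J : nat :=
  #|[set u : 'I_n * 'I_n | [&& u.1 \in I, u.2 \in J & (u.2 < u.1)%N]]%SET|.

Definition smul F G : superfun :=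
  [ffun K : {set 'I_n} => \sum_(I : {set 'I_n} | I \subset K)
               (-1) ^+ ninv I (K :\: I)%SET * F I * G (K :\: I)%SET].

Lemma smul0l G : smul 0 G = 0.
Proof.
apply/ffunP => K; rewrite !ffunE big1// => I _.
by rewrite ffunE mulr0 mul0r.
Qed.

Lemma smulDl F F' G : smul (F + F') G = smul F G + smul F' G.
Proof.
apply/ffunP => K; rewrite !ffunE -big_split; apply: eq_bigr => I _ /=.
by rewrite ffunE mulrDr mulrDl.
Qed.

Lemma smulZl (c : R) F G : smul (c *: F) G = c *: smul F G.
Proof.
apply/ffunP => K; rewrite !ffunE scaler_sumr; apply: eq_bigr => I _.
by rewrite ffunE !circle_scaleE mulrCA !mulrA.
Qed.

Definition theta i : superfun :=
  [ffun I : {set 'I_n} => (I == [set i]%SET)%:R].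

Definition dx F : superfun := [ffun I : {set 'I_n} => circle_deriv (F I)].

(** The left derivative with respect to [\theta_i]. *)
Definition dtheta i F : superfun :=
  [ffun I : {set 'I_n} =>
    if i \in I then 0 else (-1) ^+ ninv [set i]%SET I * F (i |: I)%SET].

Definition etabar i F : superfun := dtheta i F - smul (theta i) (dx F).

(** [etabar_0^(l 0) (etabar_1^(l 1) (... F))] *)
Definition etabar_pow (l : 'I_n -> nat) F : superfun :=
  foldr (fun i G => iter (l i) (etabar i) G) F (enum 'I_n).

(** The homogeneous component of parity [p] ([true] is odd). *)
Definition part p F : superfun :=
  [ffun I : {set 'I_n} => if odd #|I| == p then F I else 0].

Definition homogeneous p F : Prop := part p F = F.

(** The contact vector field [X_F]; as [|F|] is only defined for homogeneous
    [F], the formula is extended by linearity in [F]. *)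
Definition contact_field F G : superfun :=
  \sum_(p : bool)
    (smul (part p F) (dx G)
     - (2^-1 * (-1) ^+ p) *:
         \sum_(i < n) smul (etabar i (part p F)) (etabar i G)).

End Supercircle.

(** [G : density n lambda] stands for the density [G \alpha_n^lambda]. *)
Definition density (R : realType) (n : nat) (lambda : R) : Type :=
  superfun R n.

HB.instance Definition _ (R : realType) (n : nat) (lambda : R) :=
  GRing.Lmodule.on (density n lambda).

Section Densities.
Variables (R : realType) (n : nat).

Definition lie_density (lambda : R) (F : superfun R n)
    (G : density n lambda) : density n lambda :=
  contact_field F G + lambda *: smul (dx F) G.

Definition berezin_weight : R := (2 - n%:R) / 2.

Definition berezin (F : density n berezin_weight) : R :=
  circle_integral (F [set: 'I_n]%SET).

Definition pairing (lambda : R) (F : density n lambda)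
    (G : density n (berezin_weight - lambda)) : R :=
  berezin (smul F G).

End Densities.

Section DifferentialOperators.
Variables (R : realType) (n : nat).

Section Operators.
Variables (lambda mu : R).
Implicit Types (A B : density n lambda -> density n mu) (p q r : bool).

Definition op_homogeneous q A : Prop :=
  forall p phi, homogeneous p phi -> homogeneous (q (+) p) (A phi).

(** The homogeneous component of parity [q] of a linear operator. *)
Definition op_part q A : density n lambda -> density n mu :=
  fun phi => \sum_(r : bool) part (q (+) r) (A (part r phi)).

(** The action of [X_F] on operators, extended bilinearly from the case of
    homogeneous [F] and [A], where it is
    [L_F \o A - (-1)^(|A||F|) (A \o L_F)]. *)
Definition lie_op (F : superfun R n) A : density n lambda -> density n mu :=
  fun phi => \sum_(p : bool) \sum_(q : bool)
    (lie_density (part p F) (op_part q A phi)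
     - (-1) ^+ (q && p) *: op_part q A (lie_density (part p F) phi)).

(** Differential operators of order at most [k], where [k2] is [2 k]; the
    entries of the multi-index [l] are thus bounded by [k2]. *)
Definition is_diffop (k2 : nat) A : Prop :=
  exists a : {ffun 'I_n -> 'I_k2.+1} -> superfun R n,
    forall phi, A phi =
      \sum_(l : {ffun 'I_n -> 'I_k2.+1} | (\sum_(i < n) l i <= k2)%N)
        smul (a l) (etabar_pow (fun i => l i : nat) phi).

Definition diffop_pred (k2 : nat) :
    {pred density n lambda -> density n mu} :=
  fun A => `[< is_diffop k2 A >].

Record diffop (k2 : nat) := DiffOp {
  diffop_val :> density n lambda -> density n mu;
  _ : diffop_val \in diffop_pred k2 }.

HB.instance Definition _ (k2 : nat) := [isSub for @diffop_val k2].
HB.instance Definition _ (k2 : nat) := [Choice of diffop k2 by <:].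

Lemma diffopP k2 A : reflect (is_diffop k2 A) (A \in diffop_pred k2).
Proof. exact: asboolP. Qed.

Lemma diffop_submod k2 : submod_closed (diffop_pred k2).
Proof.
split=> [|c A B /diffopP[a Aa] /diffopP[b Bb]]; apply/diffopP.
  exists (fun=> 0) => phi; rewrite big1// => l _; exact: smul0l.
exists (fun l => c *: a l + b l) => phi.
transitivity (c *: A phi + B phi) => //.
rewrite Aa Bb scaler_sumr -[RHS]/(\sum_(l | _) _ : superfun R n).
under [RHS]eq_bigr do rewrite smulDl smulZl.
exact/esym/big_split.
Qed.

HB.instance Definition _ (k2 : nat) :=
  GRing.SubChoice_isSubLmodule.Build R (density n lambda -> density n mu)
    (diffop_pred k2) (diffop k2) (diffop_submod k2).

End Operators.

(** [K(n)]-invariance of a map between spaces of differential operators. The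
    existence of [XA] says that [X_F \cdot A] is again a differential operator
    of order at most [k]. *)
Definition contact_invariant (k2 : nat) (lambda mu lambda' mu' : R)
    (T : diffop lambda mu k2 -> diffop lambda' mu' k2) : Prop :=
  forall (F : superfun R n) (A : diffop lambda mu k2),
    exists2 XA : diffop lambda mu k2,
      lie_op F A = XA & lie_op F (T A) = T XA.

(** [B] is the conjugate of the operator [A] of parity [a]. *)
Definition conjugate (lambda mu : R) (a : bool)
    (A : density n lambda -> density n mu)
    (B : density n (berezin_weight R n - mu) ->
         density n (berezin_weight R n - lambda)) : Prop :=
  forall b phi, homogeneous b phi -> forall psi,
    pairing (A phi) psi = (-1) ^+ (a && b) * pairing phi (B psi).

End DifferentialOperators.

(* Main.v *)
Require Import Defs.
From HB Require Import structures.
From mathcomp Require Import all_boot all_order all_algebra ring lra.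
From mathcomp Require Import all_classical all_reals all_analysis.
From mathcomp Require Import fintype finset.

Set Implicit Arguments.
Unset Strict Implicit.
Unset Printing Implicit Defensive.

Import Order.TTheory GRing.Theory Num.Theory.
Import numFieldNormedType.Exports.

Local Open Scope ring_scope.

(** Conjugation is a formal adjunction, so the proof computes the adjoints of
    the generators of the differential operators and then checks that the Lie
    derivative is skew-adjoint.

    Multiplication by a function [f] is its own conjugate, because the product
    of superfunctions is associative and supercommutative ([smulA], [smulC]).
    Each [\overline\eta_i] is an odd superderivation ([etabarM]) all of whose
    values have Berezin integral zero ([berezin_etabar]): its first term has no
    [\theta_i], and its second one has an [x]-derivative as top coefficient.
    Hence the conjugate of [\overline\eta_i] is [- \overline\eta_i]. Since
    conjugation reverses products up to sign, every homogeneous operator of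
    order at most [k] has a conjugate of order at most [k]
    ([homog_diffop_conjugate]). The conjugate is unique because the pairing is
    nondegenerate: pairing [F] with a suitable monomial gives the integral of
    the square of any chosen coefficient of [F] ([berezin_nondegenerate]).

    For invariance, [L_F] obeys the Leibniz rule with respect to products of
    densities ([lieM]), and the integral of [L_F G] is zero for densities [G]
    of weight [(2 - n) / 2] ([berezin_lie0]). So [L_F] is minus its own
    conjugate ([berezin_lie]), and conjugating the supercommutator of [L_F]
    with [A] gives the supercommutator of [L_F] with the conjugate of [A]
    ([conjugate_ops_lie_bracket]). That the supercommutator does not raise the
    order comes from the contact structure: [X_F] and [\overline\eta_i]
    supercommute to a combination of the [\overline\eta_j] with function
    coefficients ([contact_field_etabar]), with no [\partial_x] left over.

    Bijectivity follows from symmetry. The conjugation formula, once written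
    with a sign that does not involve the parity of the operator
    ([conjugate_pair]), is symmetric in the operator and its conjugate
    ([conjugate_pair_sym]), so that conjugating twice is the identity. *)

(** * Integration on the circle *)

Section CircleIntegral.
Variable R : realType.
Implicit Types f g : circle_fun R.

Local Notation mu := (@lebesgue_measure R).

Lemma circle_fun_derivable f x : derivable f x 1.
Proof. by case: f => f /= /circle_smoothP[_ sf]; exact: (sf 0%N x). Qed.

Lemma circle_fun_continuous f : continuous f.
Proof.
by move=> x; apply/differentiable_continuous/derivable1_diffP;
  exact: circle_fun_derivable.
Qed.

Lemma circle_fun_integrable f (a b : R) :
  mu.-integrable `[a, b] (EFin \o f).
Proof.
apply: continuous_compact_integrable; first exact: segment_compact.
exact/continuous_subspaceT/circle_fun_continuous.
Qed.

Lemma circle_fun_mod f x :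
  exists2 y : R, y \in `[0, pi *+ 2[ & f x = f y.
Proof.
have [pf _] : periodic f (pi *+ 2) /\ smooth f.
  by case: f => f /= /circle_smoothP.
have pi2 : 0 < pi *+ 2 :> R by rewrite mulrn_wgt0// pi_gt0.
have pfz (m : int) y : f (y + pi *+ 2 *~ m) = f y.
  case: m => m.
    exact: (periodicn pf).
  rewrite NegzE mulrNz; set v := y - _.
  by rewrite -[in RHS](subrK (pi *+ 2 *~ m.+1) y) (periodicn pf).
pose m := Num.floor (x / (pi *+ 2)).
exists (x + pi *+ 2 *~ - m); last by rewrite pfz.
have lo : m%:~R * (pi *+ 2) <= x by rewrite -ler_pdivlMr// floor_le.
have hi : x < (m + 1)%:~R * (pi *+ 2).
  by rewrite -ltr_pdivrMr// floorD1_gt.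
rewrite in_itv/= mulrNz -[_ *~ m]mulrzl.
by move: lo hi; rewrite intrD; lra.
Qed.

Lemma circle_integralD f g :
  circle_integral (f + g) = circle_integral f + circle_integral g.
Proof. by rewrite /circle_integral -RintegralD//;
  exact: circle_fun_integrable. Qed.

Lemma circle_integralZ (c : R) f :
  circle_integral (c *: f) = c * circle_integral f.
Proof. by rewrite /circle_integral -RintegralZl//;
  exact: circle_fun_integrable. Qed.

(** A periodic function takes the same value at both ends of a period. *)
Lemma circle_integral_deriv f : circle_integral (circle_deriv f) = 0.
Proof.
have pi2 : 0 < pi *+ 2 :> R by rewrite mulrn_wgt0// pi_gt0.
have cf := @circle_fun_continuous f.
rewrite /circle_integral /Rintegral (@continuous_FTC2 _ _ f)//.
- case: f {cf} => f /= /circle_smoothP[pf _].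
  have -> : f (pi *+ 2) = f 0 by rewrite -[RHS]pf add0r.
  by rewrite subrr.
- exact/continuous_subspaceT/circle_fun_continuous.
- split=> [x _||]; first exact: circle_fun_derivable.
  + exact/cvg_at_right_filter/cf.
  + exact/cvg_at_left_filter/cf.
Qed.

(** The primitive of [g ^ 2] is nondecreasing with equal values at the ends of
    the period, so it is constant and its derivative [g ^ 2] vanishes. *)
Lemma circle_integral_sqr_eq0 g : circle_integral (g * g) = 0 -> g = 0.
Proof.
have pi2 : 0 < pi *+ 2 :> R by rewrite mulrn_wgt0// pi_gt0.
set h := g * g => ih0.
have hge0 x : 0 <= h x by exact: sqr_ge0.
pose H x := \int[mu]_(t in `[0, x]) h t.
have Hx0 x : x \in `]0, pi *+ 2[ -> H x = 0.
  rewrite in_itv/= => /andP[x0 x2]; apply/eqP; rewrite eq_le.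
  rewrite [X in _ && X]Rintegral_ge0// andbT -subr_ge0.
  rewrite -[X in X - _]ih0 /circle_integral.
  rewrite Rintegral_itvB ?bnd_simp ?(ltW x0) ?(ltW x2)//.
    by apply: Rintegral_ge0 => y _; exact: hge0.
  exact: circle_fun_integrable.
have g0 x : x \in `]0, pi *+ 2[ -> g x = 0.
  move=> x02; have /andP[x0 x2] := x02.
  have [_] := @continuous_FTC1_closed _ h 0 x (pi *+ 2) x2
    (@circle_fun_integrable h _ _) x0 (@circle_fun_continuous h x).
  have -> : derive1 (fun y => \int[mu]_(t in `[0, y]) h t) x = 0.
    rewrite derive1E (@near_eq_derive _ _ _ _ (cst 0))// ?derive_cst//.
    near=> y; apply: Hx0; near: y; apply: near_in_itvoo.
    exact: x02.
  by move=> /esym/eqP; rewrite mulf_eq0 => /orP[]/eqP.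
have g00 : g 0 = 0.
  apply: (@cvg_unique _ (@Rhausdorff R) (g x @[x --> 0^'+])%classic).
    exact/cvg_at_right_filter/circle_fun_continuous.
  apply: cvg_near_cst; near=> y; apply: g0; rewrite in_itv/=.
  by apply/andP; split; near: y; [exact: nbhs_right_gt|exact: nbhs_right_lt].
apply/circle_funP => x; have [y] := circle_fun_mod g x.
rewrite in_itv/= le_eqVlt => /andP[/predU1P[<-|y0] y2 ->] //.
by apply: g0; rewrite in_itv/= y0.
Unshelve. all: by end_near.
Qed.
End CircleIntegral.

(** * The supercommutative algebra of superfunctions *)

Section Grassmann.
Variables (R : realType) (n : nat).
Local Notation superfun := (superfun R n).
Implicit Types (F G H : superfun) (i j : 'I_n) (I J K : {set 'I_n}).
Implicit Types (p q : bool).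

Local Notation "F ** G" := (smul F G) (at level 40, left associativity).

Lemma ninvE I J : ninv I J = (\sum_(u in I) \sum_(v in J) (v < u))%N.
Proof.
rewrite /ninv -sum1dep_card pair_big_dep/= big_mkcond [RHS]big_mkcond/=.
by apply: eq_bigr => -[u v] _ /=; case: (u \in I); case: (v \in J);
  case: ltnP.
Qed.

(** Additivity in each argument turns the sign identities between products of
    monomials into identities between exponents. *)
Lemma ninvUl I J K : [disjoint I & J] ->
  ninv (I :|: J) K = (ninv I K + ninv J K)%N.
Proof. by move=> dIJ; rewrite !ninvE -bigU//; apply: eq_bigl => u;
  rewrite inE. Qed.

Lemma ninvUr I J K : [disjoint J & K] ->
  ninv I (J :|: K) = (ninv I J + ninv I K)%N.
Proof.
move=> dJK; rewrite !ninvE -big_split; apply: eq_bigr => u _.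
by rewrite -bigU//; apply: eq_bigl => v; rewrite inE.
Qed.

(** Each pair in [I * J] is an inversion in exactly one of the two orders. *)
Lemma ninvC I J : [disjoint I & J] -> (ninv I J + ninv J I = #|I| * #|J|)%N.
Proof.
move=> dIJ; rewrite !ninvE [X in (_ + X)%N]exchange_big -big_split/=.
rewrite -sum_nat_const; apply: eq_bigr => u uI; rewrite -big_split/=.
rewrite -sum1_card; apply: eq_bigr => v vJ.
have : u != v by apply: contraTneq vJ => <-; rewrite (disjointFr dIJ uI).
by rewrite neq_ltn; case: ltngtP.
Qed.

Lemma ninv0l I : ninv set0 I = 0%N.
Proof. by rewrite ninvE big_set0. Qed.

Lemma ninv0r I : ninv I set0 = 0%N.
Proof. by rewrite ninvE big1// => u _; rewrite big_set0. Qed.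

(** Both sides sum over the ordered decompositions of [K] into three disjoint
    parts; the signs agree by additivity of [ninv]. *)
Lemma smulA F G H : F ** (G ** H) = F ** G ** H.
Proof.
apply/ffunP => K; rewrite !ffunE.
under [RHS]eq_bigr do rewrite !ffunE mulr_sumr mulr_suml.
rewrite (exchange_big_dep (fun I => I \subset K)) /=; last first.
  by move=> L I LK IL; exact: subset_trans IL LK.
(* The first part [I] is fixed; the second part is [J = L :\: I], where [L] is
   the union of the first two. *)
apply: eq_bigr => I IK; rewrite ffunE mulr_sumr.
rewrite [RHS](reindex_onto (fun J => I :|: J) (fun L => L :\: I)) /=;
  last first.
  by move=> L /andP[_ IL]; rewrite -{1}(setIidPr IL) setID.
have dJ J : J \subset K :\: I -> [disjoint I & J].
  by rewrite subsetD disjoint_sym => /andP[].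
have UDJ J : J \subset K :\: I -> (I :|: J) :\: I = J.
  move=> /dJ; rewrite setDUl setDv set0U.
  by rewrite disjoint_sym => /setDidPl.
apply: eq_big => [J|J JKI].
  apply/idP/idP => [JKI|].
    rewrite subUset IK (subsetUl I J) UDJ// eqxx !andbT/=.
    by apply: subset_trans JKI _; exact: subsetDl.
  move=> /andP[/andP[IJK _] /eqP <-]; exact: setSD.
rewrite (UDJ _ JKI) -setDDl; set M := K :\: I :\: J.
have dJM : [disjoint J & M] by rewrite disjoints_subset /M setDE
  setCI setCK subsetUr.
have -> : K :\: I = J :|: M.
  by rewrite /M -{1}(setIidPr JKI) setID.
rewrite ninvUr// ninvUl ?dJ// !exprD; ring.
Qed.

Lemma smulDr F G H : F ** (G + H) = F ** G + F ** H.
Proof.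
apply/ffunP => K; rewrite !ffunE -big_split; apply: eq_bigr => I _ /=.
by rewrite ffunE mulrDr.
Qed.

Lemma smulZr (c : R) F G : F ** (c *: G) = c *: (F ** G).
Proof.
apply/ffunP => K; rewrite !ffunE scaler_sumr; apply: eq_bigr => I _.
by rewrite ffunE !circle_scaleE mulrCA.
Qed.

Lemma circle_signZ k (f : circle_fun R) : (-1) ^+ k *: f = (-1) ^+ k * f.
Proof.
rewrite -(signr_odd R) -(signr_odd (circle_fun R)).
by case: (odd k); rewrite ?expr1 ?scaleN1r ?mulN1r// ?expr0 scale1r mul1r.
Qed.

Lemma circle_derivP (c : R) (f g : circle_fun R) :
  circle_deriv (c *: f + g) = c *: circle_deriv f + circle_deriv g.
Proof.
apply/circle_funP => x; rewrite circle_scaleE /= !fctE/=.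
have -> : (fun x0 : R => c * f x0 + g x0) = (c *: (f : R -> R)) + g by [].
rewrite !derive1E deriveD//; last exact: circle_fun_derivable.
  by rewrite deriveZ//; exact: circle_fun_derivable.
by apply: derivableZ; exact: circle_fun_derivable.
Qed.

HB.instance Definition _ :=
  GRing.isLinear.Build R (circle_fun R) (circle_fun R) *:%R
    (@circle_deriv R) circle_derivP.

Lemma circle_derivM (f g : circle_fun R) :
  circle_deriv (f * g) = circle_deriv f * g + f * circle_deriv g.
Proof.
apply/circle_funP => x; rewrite /= !fctE/=.
have -> : (fun x0 : R => f x0 * g x0) = (f : R -> R) * g by [].
rewrite !derive1E deriveM; try exact: circle_fun_derivable.
by rewrite addrC; congr (_ + _); exact: mulrC.
Qed.

Fact smul_linear F : linear (smul F).
Proof. by move=> c G H; rewrite smulDr smulZr. Qed.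

HB.instance Definition _ F :=
  GRing.isLinear.Build R superfun superfun *:%R (smul F) (smul_linear F).

Fact dx_linear : linear (@dx R n).
Proof. by move=> c F G; apply/ffunP => I; rewrite !ffunE linearP. Qed.

HB.instance Definition _ :=
  GRing.isLinear.Build R superfun superfun *:%R (@dx R n) dx_linear.

Fact part_linear p : linear (@part R n p).
Proof.
move=> c F G; apply/ffunP => I; rewrite !ffunE.
by case: ifP => // _; rewrite scaler0 addr0.
Qed.

HB.instance Definition _ p :=
  GRing.isLinear.Build R superfun superfun *:%R (@part R n p) (part_linear p).

Fact dtheta_linear i : linear (@dtheta R n i).
Proof.
move=> c F G; apply/ffunP => I; rewrite !ffunE.
case: ifP => // _; first by rewrite scaler0 addr0.
by rewrite -!circle_signZ scalerDr !scalerA mulrC.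
Qed.

HB.instance Definition _ i :=
  GRing.isLinear.Build R superfun superfun *:%R (@dtheta R n i)
    (dtheta_linear i).

Fact etabar_linear i : linear (@etabar R n i).
Proof.
by move=> c F G; rewrite /etabar !linearP/= scalerDr addrACA.
Qed.

HB.instance Definition _ i :=
  GRing.isLinear.Build R superfun superfun *:%R (@etabar R n i)
    (etabar_linear i).

Lemma smulNr F G : F ** - G = - (F ** G).
Proof. exact: (linearN (smul F)). Qed.

Lemma smulBr F G H : F ** (G - H) = F ** G - F ** H.
Proof. exact: (linearB (smul F)). Qed.

Lemma smul_sumr (T : Type) (r : seq T) (P : pred T) F (G : T -> superfun) :
  F ** (\sum_(t <- r | P t) G t) = \sum_(t <- r | P t) F ** G t.
Proof. exact: (linear_sum (smul F)). Qed.

Lemma etabarB i F G : etabar i (F - G) = etabar i F - etabar i G.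
Proof. exact: (linearB (etabar i)). Qed.

Lemma etabarD i F G : etabar i (F + G) = etabar i F + etabar i G.
Proof. exact: (linearD (etabar i)). Qed.

Lemma etabarZ i (c : R) F : etabar i (c *: F) = c *: etabar i F.
Proof. exact: (linearZ_LR (etabar i)). Qed.

Lemma etabar_sum i (T : Type) (r : seq T) (P : pred T) (F : T -> superfun) :
  etabar i (\sum_(t <- r | P t) F t) = \sum_(t <- r | P t) etabar i (F t).
Proof. exact: (linear_sum (etabar i)). Qed.

Lemma smulNl F G : (- F) ** G = - (F ** G).
Proof. by rewrite -scaleN1r smulZl scaleN1r. Qed.

Lemma smul_suml (T : Type) (r : seq T) (P : pred T) (F : T -> superfun) G :
  (\sum_(t <- r | P t) F t) ** G = \sum_(t <- r | P t) F t ** G.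
Proof.
exact: (big_morph (fun F => F ** G) (fun F F' => smulDl F F' G) (smul0l G)).
Qed.

Lemma homogeneousP p F :
  homogeneous p F <-> forall I, odd #|I| != p -> F I = 0.
Proof.
split=> [<- I|F0]; first by rewrite ffunE => /negPf ->.
by apply/ffunP => I; rewrite ffunE; case: eqP => // /eqP /F0.
Qed.

Lemma homogeneous_part p F : homogeneous p (part p F).
Proof. by apply/homogeneousP => I /negPf pI; rewrite ffunE pI. Qed.

Lemma part_neq0 p q F : homogeneous p F -> p != q -> part q F = 0.
Proof.
move=> /homogeneousP F0 pq; apply/ffunP => I; rewrite !ffunE.
by case: eqP => // Iq; apply: F0; rewrite Iq eq_sym.
Qed.

Lemma sum_part F : \sum_(p : bool) part p F = F.
Proof.
apply/ffunP => I; rewrite big_bool !ffunE.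
by case: (odd _); rewrite ?addr0 ?add0r.
Qed.

Lemma homogeneousD p F G :
  homogeneous p F -> homogeneous p G -> homogeneous p (F + G).
Proof. by rewrite /homogeneous linearD/= => -> ->. Qed.

Lemma homogeneousZ p (c : R) F : homogeneous p F -> homogeneous p (c *: F).
Proof. by rewrite /homogeneous linearZ/= => ->. Qed.

Lemma homogeneousN p F : homogeneous p F -> homogeneous p (- F).
Proof. by rewrite /homogeneous linearN/= => ->. Qed.

Lemma homogeneous0 p : homogeneous p (0 : superfun).
Proof. by rewrite /homogeneous linear0. Qed.

Lemma homogeneous_sum p (T : Type) (r : seq T) (P : pred T)
    (F : T -> superfun) :
  (forall t, P t -> homogeneous p (F t)) ->
  homogeneous p (\sum_(t <- r | P t) F t).
Proof.
by move=> hF; rewrite /homogeneous linear_sum; apply: eq_bigr => t /hF.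
Qed.

Lemma odd_cardD I K : I \subset K -> odd #|K :\: I| = odd #|K| (+) odd #|I|.
Proof. by move=> IK; rewrite cardsD (setIidPr IK) oddB// subset_leq_card. Qed.

Lemma homogeneousM p q F G :
  homogeneous p F -> homogeneous q G -> homogeneous (p (+) q) (F ** G).
Proof.
move=> /homogeneousP F0 /homogeneousP G0; apply/homogeneousP => K Kpq.
rewrite ffunE big1// => I IK; have [Ip|/F0 ->] := eqVneq (odd #|I|) p.
  rewrite G0 ?mulr0// odd_cardD// Ip.
  by move: Kpq; case: (odd _); case: p {Ip F0}; case: q {G0}.
by rewrite mulr0 mul0r.
Qed.

Lemma smulC p q F G : homogeneous p F -> homogeneous q G ->
  F ** G = (-1) ^+ (p && q) *: (G ** F).
Proof.
move=> /homogeneousP F0 /homogeneousP G0; apply/ffunP => K.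
rewrite !ffunE (reindex_onto (fun J => K :\: J) (fun J => K :\: J)) /=;
  last first.
  by move=> I IK; rewrite setDDr setDv set0U (setIidPr IK).
rewrite scaler_sumr; apply: eq_big => J.
  rewrite subsetDl setDDr setDv set0U/=; apply/eqP/idP => [<-|/setIidPr//].
  exact: subsetIl.
move=> /andP[_ /eqP JK]; rewrite JK circle_signZ.
have {}JK : J \subset K by rewrite -JK subsetDl.
have [Jq|/G0 ->] := eqVneq (odd #|J|) q; last by rewrite !(mulr0, mul0r).
have [KJp|/F0 ->] := eqVneq (odd #|K :\: J|) p; last by rewrite !(mulr0, mul0r).
have dJ : [disjoint K :\: J & J] by rewrite disjoints_subset setDE subsetIr.
have -> : (-1) ^+ ninv (K :\: J) J = (-1) ^+ (p && q) * (-1) ^+ ninv J (K :\: J)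
  :> circle_fun R.
  rewrite -KJp -Jq -oddM -(ninvC dJ) signr_odd exprD -mulrA -expr2.
  by rewrite sqrr_sign mulr1.
ring.
Qed.

Lemma theta_smulE i F K : (theta R i ** F) K =
  if i \in K then (-1) ^+ ninv [set i] (K :\ i) * F (K :\ i) else 0.
Proof.
rewrite ffunE; case: ifP => iK.
  rewrite (bigD1 [set i]) ?sub1set//= ffunE eqxx mulr1 big1 ?addr0// => I.
  by move=> /andP[_ /negPf iI]; rewrite ffunE iI mulr0 mul0r.
rewrite big1// => I IK; rewrite ffunE; case: eqP => [Ii|]; last first.
  by rewrite mulr0 mul0r.
by move: IK; rewrite Ii sub1set iK.
Qed.

Lemma homogeneous_theta i : homogeneous true (theta R i).
Proof.
apply/homogeneousP => I; rewrite ffunE; case: (I =P _) => // ->.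
by rewrite cards1.
Qed.

Lemma homogeneous_dx p F : homogeneous p F -> homogeneous p (dx F).
Proof.
by move=> /homogeneousP F0; apply/homogeneousP => I /F0; rewrite ffunE => ->;
  rewrite linear0.
Qed.

Lemma homogeneous_dtheta i p F :
  homogeneous p F -> homogeneous (~~ p) (dtheta i F).
Proof.
move=> /homogeneousP F0; apply/homogeneousP => I Ip; rewrite ffunE.
case: ifP => // iI; rewrite F0 ?mulr0// cardsU1 iI/=.
by case: p {F0} Ip => /=; case: (odd _).
Qed.

Lemma homogeneous_etabar i p F :
  homogeneous p F -> homogeneous (~~ p) (etabar i F).
Proof.
move=> hF; apply: homogeneousD; first exact: homogeneous_dtheta.
apply: homogeneousN; rewrite -addTb.
by apply: homogeneousM; [exact: homogeneous_theta|exact: homogeneous_dx].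
Qed.

(** The signs are constants, hence are not affected by [dx]. *)
Lemma dxM F G : dx (F ** G) = dx F ** G + F ** dx G.
Proof.
apply/ffunP => K; rewrite !ffunE linear_sum -big_split; apply: eq_bigr =>
  I _ /=.
by rewrite -mulrA -circle_signZ linearZ/= circle_derivM !ffunE circle_signZ;
  ring.
Qed.

Lemma dx_theta i : dx (theta R i) = 0.
Proof.
apply/ffunP => I; rewrite !ffunE; case: (_ == _); last by rewrite linear0.
by apply/circle_funP => x; exact: derive1_cst.
Qed.

End Grassmann.

(** * The odd superderivations *)

Section Superderivations.
Variables (R : realType) (n : nat).
Local Notation superfun := (superfun R n).
Implicit Types (F G H : superfun) (i j : 'I_n) (I J K : {set 'I_n}).
Implicit Types (p q : bool).

Local Notation "F ** G" := (smul F G) (at level 40, left associativity).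

Lemma theta_anti i j F :
  theta R i ** (theta R j ** F) = - (theta R j ** (theta R i ** F)).
Proof.
rewrite !smulA (smulC (homogeneous_theta R i) (homogeneous_theta R j)).
by rewrite expr1 scaleN1r smulNl.
Qed.

Lemma theta_sqr i F : theta R i ** (theta R i ** F) = 0.
Proof.
apply/ffunP => K; rewrite theta_smulE; case: ifP => iK; last by rewrite ffunE.
by rewrite theta_smulE setD11 mulr0 ffunE.
Qed.

Definition theta_free i F := forall I, i \in I -> F I = 0.

Lemma theta_freeD i F G :
  theta_free i F -> theta_free i G -> theta_free i (F + G).
Proof. by move=> F0 G0 I iI; rewrite ffunE F0// G0// addr0. Qed.

Lemma theta_freeZ i (c : R) F : theta_free i F -> theta_free i (c *: F).
Proof. by move=> F0 I iI; rewrite ffunE F0// scaler0. Qed.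

Lemma theta_freeM i F G :
  theta_free i F -> theta_free i G -> theta_free i (F ** G).
Proof.
move=> F0 G0 K iK; rewrite ffunE big1// => I IK.
have [/F0 ->|iI] := boolP (i \in I); first by rewrite mulr0 mul0r.
by rewrite G0 ?mulr0// inE iI.
Qed.

Lemma theta_free_dtheta i F : theta_free i (dtheta i F).
Proof. by move=> I iI; rewrite ffunE iI. Qed.

(** In a decomposition into parts free of [\theta_i], as every superfunction has
    by [theta_decomp], the left derivative is the cofactor of [\theta_i]. This
    turns the Leibniz rule into a computation in the algebra. *)
Lemma dtheta_unique i F G :
  theta_free i F -> theta_free i G -> dtheta i (F + theta R i ** G) = G.
Proof.
move=> F0 G0; apply/ffunP => K; rewrite ffunE.
case: ifP => [/G0 //|iK]; rewrite ffunE F0 ?setU11// add0r.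
rewrite theta_smulE setU11 setU1K ?iK// mulrA -expr2.
by rewrite sqrr_sign mul1r.
Qed.

(** The part [F_0] of the decomposition [F = F_0 + \theta_i F_1]. *)
Definition theta_rest i F : superfun :=
  [ffun I : {set 'I_n} => if i \in I then 0 else F I].

Lemma theta_free_rest i F : theta_free i (theta_rest i F).
Proof. by move=> I iI; rewrite ffunE iI. Qed.

Lemma homogeneous_rest i p F :
  homogeneous p F -> homogeneous p (theta_rest i F).
Proof.
by move=> /homogeneousP F0; apply/homogeneousP => I /F0 FI0;
  rewrite ffunE FI0 if_same.
Qed.

Lemma theta_decomp i F : F = theta_rest i F + theta R i ** dtheta i F.
Proof.
apply/ffunP => K; rewrite ffunE theta_smulE ffunE.
case: ifP => iK; last by rewrite addr0.
by rewrite add0r ffunE setD11 setD1K// mulrA -expr2 sqrr_sign mul1r.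
Qed.

Lemma smul_theta i p F G : homogeneous p F ->
  F ** (theta R i ** G) = (-1) ^+ p *: (theta R i ** (F ** G)).
Proof.
move=> hF; rewrite !smulA (smulC hF (homogeneous_theta R i)) andbT.
by rewrite smulZl.
Qed.

(** With [F = a + \theta_i b] and [G = c + \theta_i d], where [a], [b], [c],
    [d] are free of [\theta_i], the product is
    [a c + \theta_i (b c + (-1)^|F| a d)]. *)
Lemma dthetaM i p F G : homogeneous p F ->
  dtheta i (F ** G) = dtheta i F ** G + (-1) ^+ p *: (F ** dtheta i G).
Proof.
move=> hF; set b := dtheta i F; set d := dtheta i G.
set a := theta_rest i F; set c := theta_rest i G.
have hb : homogeneous (~~ p) b by exact: homogeneous_dtheta.
have ha : homogeneous p a by exact: homogeneous_rest.
have bfree : theta_free i b by exact: theta_free_dtheta.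
have dfree : theta_free i d by exact: theta_free_dtheta.
have afree : theta_free i a by exact: theta_free_rest.
have cfree : theta_free i c by exact: theta_free_rest.
have FE : F = a + theta R i ** b by exact: theta_decomp.
have GE : G = c + theta R i ** d by exact: theta_decomp.
have -> : F ** G = a ** c + theta R i ** (b ** c + (-1) ^+ p *: (a ** d)).
  rewrite FE GE smulDl !smulDr -!smulA (smul_theta _ _ ha) (smul_theta _ _ hb).
  rewrite linearZ/= theta_sqr scaler0 addr0 linearZ/= -addrA.
  by rewrite [X in _ + X]addrC.
rewrite dtheta_unique; last 2 first.
- exact: theta_freeM.
- by apply: theta_freeD; [|apply: theta_freeZ]; exact: theta_freeM.
rewrite GE FE smulDr smulDl (smul_theta _ _ hb) scalerDr -smulA.
by rewrite signrN scaleNr [X in _ = _ + X]addrC addrA subrK.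
Qed.

Lemma dtheta_theta i j F :
  dtheta i (theta R j ** F) = (i == j)%:R *: F - theta R j ** dtheta i F.
Proof.
rewrite (dthetaM _ _ (homogeneous_theta R j)) expr1 scaleN1r; congr (_ + _).
have [->|ij] := eqVneq i j.
  rewrite scale1r; apply/ffunP => K.
  rewrite ffunE (bigD1 set0) ?sub0set//= big1 ?addr0 => [|I /andP[_ I0]].
    by rewrite ninv0l setD0 !ffunE inE ninv0r !expr0 setU0 eqxx !mul1r.
  rewrite !ffunE; case: ifP => jI; first by rewrite mulr0 mul0r.
  case: eqP => [jIE|]; last by rewrite !(mulr0, mul0r).
  case/eqP: I0; apply/setP => x; rewrite inE; apply/negP => xI.
  have : x \in j |: I by rewrite inE xI orbT.
  by rewrite jIE inE => /eqP xj; rewrite xj jI in xI.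
rewrite scale0r; apply/ffunP => K; rewrite !ffunE big1// => I _.
rewrite !ffunE; case: ifP => iI; first by rewrite mulr0 mul0r.
case: eqP => [/setP/(_ i)|]; last by rewrite !(mulr0, mul0r).
by rewrite !inE eqxx/= (negPf ij).
Qed.

(** Swapping the order in which [\theta_i] and [\theta_j] are pulled out of a
    monomial changes the inversions by the pair [(i, j)] alone. *)
Lemma dtheta_anti i j F : dtheta i (dtheta j F) = - dtheta j (dtheta i F).
Proof.
apply/ffunP => K; rewrite !ffunE.
have [->|ij] := eqVneq i j.
  by case: ifP => jK; rewrite ?setU11 ?mulr0 oppr0.
rewrite !inE (eq_sym j i) (negPf ij)/=.
have [iK|iK] := boolP (i \in K); have [jK|jK] := boolP (j \in K);
  rewrite ?mulr0 ?oppr0//.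
have dsj : [disjoint [set i] & K] by rewrite disjoints1.
have dsi : [disjoint [set j] & K] by rewrite disjoints1.
have dsij : [disjoint [set i] & [set j]] by rewrite disjoints1 inE.
rewrite !ninvUr//.
rewrite setUCA !exprD.
have := ninvC dsij; rewrite !cards1 mulnn => ninvij.
have -> : (-1) ^+ ninv [set j] [set i] = - (-1) ^+ ninv [set i] [set j]
  :> circle_fun R.
  apply: (can_inj (signrMK (ninv [set i] [set j]))).
  by rewrite -exprD ninvij expr1 mulrN -expr2 sqrr_sign.
ring.
Qed.

Lemma dtheta_dx i F : dtheta i (dx F) = dx (dtheta i F).
Proof.
apply/ffunP => K; rewrite !ffunE; case: ifP => _; first by rewrite linear0.
by rewrite -!circle_signZ linearZ.
Qed.

Lemma etabar_dx i F : etabar i (dx F) = dx (etabar i F).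
Proof.
by rewrite /etabar linearB/= dxM dx_theta smul0l add0r dtheta_dx.
Qed.

(** [\overline\eta_i] is an odd superderivation: [\partial_{\theta_i}] is one,
    and so is [\theta_i \partial_x], the product of an odd function with an
    even derivation. *)
Lemma etabarM i p F G : homogeneous p F ->
  etabar i (F ** G) = etabar i F ** G + (-1) ^+ p *: (F ** etabar i G).
Proof.
move=> hF; rewrite /etabar (dthetaM _ _ hF) dxM !smulDr !smulDl.
rewrite !linearN/= smulNl !scalerBr (smul_theta _ _ hF) scalerA -expr2.
by rewrite sqrr_sign scale1r -smulA opprD addrACA.
Qed.

Lemma etabar_etabar i j F : etabar i (etabar j F) =
  dtheta i (dtheta j F) - (i == j)%:R *: dx F + theta R j ** dtheta i (dx F)
  - theta R i ** dtheta j (dx F) + theta R i ** (theta R j ** dx (dx F)).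
Proof.
rewrite /etabar !linearB/= dtheta_theta dxM dx_theta smul0l add0r -dtheta_dx.
by rewrite opprD !opprK !addrA.
Qed.

(** In the expansion of [etabar_etabar], the terms in [\theta_i] and [\theta_j]
    are antisymmetric in [(i, j)], so only the term in [dx F] survives the
    symmetrisation. *)
Lemma etabar_comm i j F :
  etabar i (etabar j F) = - etabar j (etabar i F) - (2 * (i == j)%:R) *: dx F.
Proof.
rewrite !etabar_etabar (dtheta_anti i j) (theta_anti i j) (eq_sym j i).
rewrite mulrDl mul1r scalerDl.
move: (dtheta j _) (_ *: _) (theta R j ** _) (theta R i ** _) (theta R j ** _).
move=> A D T1 T2 U; apply/ffunP => K; rewrite !ffunE; ring.
Qed.

End Superderivations.

(** * The Berezin integral and the Lie derivatives *)

Section ContactFields.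
Variables (R : realType) (n : nat).
Local Notation superfun := (superfun R n).
Implicit Types (F G H : superfun) (i j : 'I_n) (I J K : {set 'I_n}).
Implicit Types (p q : bool).

Local Notation "F ** G" := (smul F G) (at level 40, left associativity).

Lemma etabar_sqr i F : etabar i (etabar i F) = - dx F.
Proof.
have /eqP := etabar_comm i i F.
rewrite eqxx mulr1 [X in _ == X]addrC -subr_eq opprK -mulr2n -scaler_nat -scalerN.
by move=> /eqP/scalerI -> //; rewrite pnatr_eq0.
Qed.

Lemma berezinP (c : R) F G :
  berezin (c *: F + G : superfun) = c * berezin F + berezin G.
Proof. by rewrite /berezin !ffunE circle_integralD circle_integralZ. Qed.

Fact berezin_linear : linear_for *%R (@berezin R n : superfun -> R).
Proof. exact: berezinP. Qed.

HB.instance Definition _ :=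
  GRing.isLinear.Build R superfun R *%R (@berezin R n : superfun -> R)
    berezin_linear.

Lemma berezin_dx F : berezin (dx F) = 0.
Proof. by rewrite /berezin ffunE circle_integral_deriv. Qed.

(** The first term of [etabar i F] has no [\theta_i], and the top coefficient of
    the second one is a derivative on the circle. *)
Lemma berezin_etabar i F : berezin (etabar i F) = 0.
Proof.
have -> : berezin (etabar i F) = circle_integral
    (- (-1) ^+ ninv [set i] (setT :\ i) *: circle_deriv (F (setT :\ i))).
  congr circle_integral.
  rewrite ffunE [X in X + _]ffunE inE add0r ffunE theta_smulE inE [dx F _]ffunE.
  by rewrite scaleNr circle_signZ.
by rewrite circle_integralZ circle_integral_deriv mulr0.
Qed.

Lemma berezin_parity p F : homogeneous p F -> p != odd n -> berezin F = 0.
Proof.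
move=> /homogeneousP F0 pn; rewrite /berezin F0 ?cardsT ?card_ord 1?eq_sym//.
by rewrite -(scale0r (0 : circle_fun R)) circle_integralZ mul0r.
Qed.

(** Integrating [F] against [F_J \theta_(~: J)] isolates the integral of
    [F_J ^ 2]. *)
Lemma berezin_nondegenerate F :
  (forall b phi, homogeneous b phi -> berezin (phi ** F) = 0) -> F = 0.
Proof.
move=> F0; apply/ffunP => J; rewrite ffunE; apply: circle_integral_sqr_eq0.
pose phi : superfun := [ffun I : {set 'I_n} => if I == ~: J then F J else 0].
have /F0 : homogeneous (odd #|~: J|) phi.
  apply/homogeneousP => I; rewrite ffunE; case: (I =P _) => [->|//].
  by rewrite eqxx.
rewrite /berezin ffunE (bigD1 (~: J)) ?subsetT//= big1 ?addr0; last first.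
  by move=> I /andP[_ /negPf IJ]; rewrite ffunE IJ mulr0 mul0r.
rewrite ffunE eqxx setTD setCK -mulrA -circle_signZ circle_integralZ.
by move/eqP; rewrite mulf_eq0 signr_eq0/= => /eqP.
Qed.

(** Integration by parts: the integral of [etabar i (F ** G)] is zero. *)
Lemma berezin_etabar_adj i p F G : homogeneous p F ->
  berezin (etabar i F ** G) = - (-1) ^+ p * berezin (F ** etabar i G).
Proof.
move=> hF; have := berezin_etabar i (F ** G).
by rewrite (etabarM _ _ hF) linearD linearZ/= mulNr => /eqP;
  rewrite addr_eq0 => /eqP.
Qed.

Lemma contact_fieldE p F G : homogeneous p F -> contact_field F G =
  F ** dx G - (2^-1 * (-1) ^+ p) *: \sum_(i < n) etabar i F ** etabar i G.
Proof.
move=> hF; rewrite /contact_field (bigD1 p)//= hF [X in _ + X]big1 ?addr0// =>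
  q qp.
rewrite (part_neq0 hF) 1?eq_sym// smul0l big1 ?scaler0 ?subr0// => i _.
by rewrite linear0 smul0l.
Qed.

Fact contact_field_linear F : linear (contact_field F).
Proof.
move=> c G H; rewrite /contact_field scaler_sumr -big_split; apply: eq_bigr =>
  p _ /=.
rewrite linearP/= linearP/= scalerBr addrACA -opprD; congr (_ - _).
move: (2^-1 * _) => a; rewrite scalerA [c * a]mulrC -scalerA -scalerDr;
  congr (_ *: _).
rewrite scaler_sumr -big_split; apply: eq_bigr => i _.
by rewrite linearP/= linearP.
Qed.

HB.instance Definition _ F :=
  GRing.isLinear.Build R superfun superfun *:%R (contact_field F)
    (contact_field_linear F).

(** [lie_density] between plain superfunctions: densities of all weights have
    the same underlying functions, and products of densities mix weights. *)
Definition lie lambda F : superfun -> superfun := @lie_density R n lambda F.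

Fact lie_linear lambda F : linear (lie lambda F).
Proof.
move=> c G H; rewrite /lie /lie_density linearP/= linearP/= scalerDr.
by rewrite scalerDr !scalerA addrACA [lambda * c]mulrC.
Qed.

HB.instance Definition _ lambda F :=
  GRing.isLinear.Build R superfun superfun *:%R (lie lambda F)
    (lie_linear lambda F).

Lemma homogeneous_contact p q F G : homogeneous p F -> homogeneous q G ->
  homogeneous (p (+) q) (contact_field F G).
Proof.
move=> hF hG; rewrite (contact_fieldE _ hF).
apply: homogeneousD; first exact/homogeneousM/homogeneous_dx.
apply/homogeneousN/homogeneousZ/homogeneous_sum => i _.
have := homogeneousM (homogeneous_etabar i hF) (homogeneous_etabar i hG).
by rewrite addNb addbN negbK.
Qed.

Lemma homogeneous_lie lambda p q F G : homogeneous p F -> homogeneous q G ->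
  homogeneous (p (+) q) (lie lambda F G).
Proof.
move=> hF hG; apply: homogeneousD; first exact: homogeneous_contact.
exact/homogeneousZ/homogeneousM/hG/homogeneous_dx.
Qed.

Lemma contact_fieldM p q F G H : homogeneous p F -> homogeneous q G ->
  contact_field F (G ** H) =
  contact_field F G ** H + (-1) ^+ (p && q) *: (G ** contact_field F H).
Proof.
move=> hF hG; rewrite !(contact_fieldE _ hF) smulDl smulNl smulZl.
rewrite smulBr scalerBr addrACA -opprD; congr (_ - _).
  by rewrite dxM smulDr !smulA (smulC hF hG) smulZl.
move: (2^-1 * _) => c.
rewrite smulZr [_ *: (c *: _)]scalerA [_ * c]mulrC -scalerA -scalerDr.
congr (_ *: _); rewrite smul_suml smul_sumr scaler_sumr -big_split.
apply: eq_bigr => i _ /=.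
rewrite (etabarM _ _ hG) smulDr !smulA smulZr smulA.
rewrite (smulC (homogeneous_etabar i hF) hG) smulZl scalerA.
by congr (_ + _ *: _); case: p {hF}; case: q {hG} => /=;
  rewrite ?expr0 ?expr1 ?mulrNN ?mulr1.
Qed.

Lemma lieM lambda mu p q F G H : homogeneous p F -> homogeneous q G ->
  lie (lambda + mu) F (G ** H) =
  lie lambda F G ** H + (-1) ^+ (p && q) *: (G ** lie mu F H).
Proof.
move=> hF hG; rewrite /lie /lie_density (contact_fieldM _ hF hG).
rewrite smulDl smulDr scalerDr addrACA; congr (_ + _).
rewrite scalerDl smulZl smulA; congr (_ + _).
rewrite (smulC (homogeneous_dx hF) hG) smulZl smulZr smulA.
by rewrite !scalerA mulrC.
Qed.

(** The contact field [X_F] preserves the distribution spanned by the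
    [\overline\eta_i]. The supercommutator of [X_F] and [\overline\eta_i] has two
    terms in [\overline\eta_i(F) \partial_x], one from [F \partial_x] and one
    from the square of [\overline\eta_i]; the factor [1/2] in [X_F] is the one
    for which they cancel. *)
Lemma contact_field_etabar p F G i : homogeneous p F ->
  contact_field F (etabar i G) = (-1) ^+ p *: etabar i (contact_field F G)
    + 2^-1 *: \sum_(j < n) etabar i (etabar j F) ** etabar j G.
Proof.
move=> hF; rewrite !(contact_fieldE _ hF) etabarB etabarZ etabar_sum.
rewrite (etabarM _ _ hF) etabar_dx.
have -> : \sum_(j < n) etabar i (etabar j F ** etabar j G) =
    \sum_(j < n) etabar i (etabar j F) ** etabar j G
    - (-1) ^+ (~~ p) *: \sum_(j < n) etabar j F ** etabar j (etabar i G)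
    - ((-1) ^+ (~~ p) * 2) *: (etabar i F ** dx G).
  (* The correction from exchanging [etabar i] and [etabar j], written as a sum
     over [j] to be compared termwise. *)
  have -> : ((-1) ^+ (~~ p) * 2) *: (etabar i F ** dx G) =
      \sum_(j < n)
        ((-1) ^+ (~~ p) * (2 * (i == j)%:R) : R) *: (etabar j F ** dx G).
    rewrite (bigD1 i)//= eqxx mulr1 big1 ?addr0// => j /negPf ji.
    by rewrite eq_sym ji !mulr0 scale0r.
  rewrite scaler_sumr -!sumrB; apply: eq_bigr => j _.
  rewrite (etabarM _ _ (homogeneous_etabar j hF)) (etabar_comm i j G).
  rewrite (smulBr (etabar j F)) (smulNr (etabar j F)) (smulZr _ (etabar j F)).
  by rewrite scalerBr scalerN scalerA addrA.
move: (\sum_(j < n) etabar i (etabar j F) ** etabar j G) => S1.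
move: (\sum_(j < n) etabar j F ** etabar j (etabar i G)) => S2.
move: (etabar i F ** dx G) (F ** dx (etabar i G)) => U V.
have hU : 2^-1 *: (2 *: U) = U.
  by rewrite scalerA mulVf ?pnatr_eq0// scale1r.
rewrite -!scalerA !scalerBr; case: p {hF};
  rewrite /= ?expr0 ?expr1 ?scaleN1r ?scale1r.
all: rewrite !scalerN hU; move: (_ *: S1) (_ *: S2) => {hU}T1 T2.
all: by apply/ffunP => K; rewrite !ffunE; ring.
Qed.

Lemma lie_etabar mu p F G i : homogeneous p F ->
  lie mu F (etabar i G) = (-1) ^+ p *: etabar i (lie mu F G)
    + 2^-1 *: \sum_(j < n) etabar i (etabar j F) ** etabar j G
    - (mu * (-1) ^+ p) *: (etabar i (dx F) ** G).
Proof.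
move=> hF; rewrite /lie /lie_density (contact_field_etabar _ _ hF).
rewrite etabarD etabarZ (etabarM _ _ (homogeneous_dx hF)).
move: (etabar i (contact_field F G)) (\sum_(_ < _) _) (dx F ** _)
  (etabar i (dx F) ** G) => X S W Z.
rewrite !scalerDr !scalerA [_ * mu * _]mulrAC -expr2 sqrr_sign mul1r.
rewrite [_ * mu]mulrC; move: (_ *: X) (_ *: S) (_ *: W) (_ *: Z) =>
  {}X {}S {}W {}Z.
by apply/ffunP => K; rewrite !ffunE; ring.
Qed.

(** The terms [\overline\eta_i(F) \overline\eta_i(G)] each integrate to
    that of [F' G] up to sign, as does [F G']; the weight is the one for which
    these contributions cancel. *)
Lemma berezin_lie0 p F G : homogeneous p F ->
  berezin (lie (berezin_weight R n) F G) = 0.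
Proof.
move=> hF; have Fd : berezin (F ** dx G) = - berezin (dx F ** G).
  have := berezin_dx (F ** G); rewrite dxM linearD/= => /eqP.
  by rewrite addrC addr_eq0 => /eqP.
have Fe i :
    berezin (etabar i F ** etabar i G) = - (-1) ^+ p * berezin (dx F ** G).
  have := berezin_etabar_adj i G (homogeneous_etabar i hF).
  rewrite etabar_sqr smulNl linearN/=.
  move: (berezin _) (berezin _) => X Y.
  by case: (p); rewrite /= ?expr0 ?expr1 => XY; lra.
rewrite /lie /lie_density (contact_fieldE _ hF) !linearD/= linearN/= !linearZ/=.
rewrite Fd linear_sum/= (eq_bigr _ (fun i _ => Fe i)) sumr_const card_ord.
rewrite /berezin_weight -[_ *+ n]mulr_natr /GRing.scale/=.
move: (berezin _) => Y.
by case: p {hF Fd Fe}; rewrite ?expr0 ?expr1; field.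
Qed.

(** The Lie derivative is skew for the pairing, since the Lie derivative of a
    product of total weight [(2 - n) / 2] has integral zero. *)
Lemma berezin_lie lambda p b F phi psi : homogeneous p F -> homogeneous b phi ->
  berezin (lie lambda F phi ** psi) =
  - (-1) ^+ (p && b) * berezin (phi ** lie (berezin_weight R n - lambda) F psi).
Proof.
move=> hF hphi; have := berezin_lie0 (phi ** psi) hF.
rewrite -{1}(subrKC lambda (berezin_weight R n)) (lieM _ _ _ hF hphi).
by rewrite linearD/= linearZ/= mulNr => /eqP; rewrite addr_eq0 => /eqP.
Qed.

End ContactFields.

(** * Homogeneous differential operators *)

Section HomogeneousOperators.
Variables (R : realType) (n : nat).
Local Notation superfun := (superfun R n).
Implicit Types (F G H : superfun) (i j : 'I_n) (I J K : {set 'I_n}).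
Implicit Types (p q : bool).

Local Notation "F ** G" := (smul F G) (at level 40, left associativity).
Implicit Types (k : nat) (A B : superfun -> superfun).

Lemma lie_smul mu p q F f G : homogeneous p F -> homogeneous q f ->
  lie mu F (f ** G) =
  contact_field F f ** G + (-1) ^+ (p && q) *: (f ** lie mu F G).
Proof.
move=> hF hf; rewrite -{1}(add0r mu) (lieM _ _ _ hF hf).
by rewrite [lie 0 F f]/lie /lie_density scale0r addr0.
Qed.

(** Homogeneous differential operators of order at most [k / 2] and given
    parity, by generators. New factors enter on the left only; that functions
    and [\overline\eta_i] may also enter on the right is then a matter of
    induction, and so are conjugation and the Lie bracket, for which the ordered
    monomials of [is_diffop] would be unwieldy. *)
Inductive homog_diffop : nat -> bool -> (superfun -> superfun) -> Prop :=
| homog_diffop_id k : homog_diffop k false (fun phi => phi)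
| homog_diffop_lin k p (c : R) A B : homog_diffop k p A -> homog_diffop k p B ->
    homog_diffop k p (fun phi => c *: A phi + B phi)
| homog_diffop_smul k p q f A : homogeneous q f -> homog_diffop k p A ->
    homog_diffop k (q (+) p) (fun phi => f ** A phi)
| homog_diffop_etabar k p i A : homog_diffop k p A ->
    homog_diffop k.+1 (~~ p) (fun phi => etabar i (A phi)).

Lemma homog_diffop_ext k p A B :
  A =1 B -> homog_diffop k p A -> homog_diffop k p B.
Proof. by move=> /funext ->. Qed.

Lemma homog_diffop_zero k p : homog_diffop k p (fun=> 0).
Proof.
apply: (@homog_diffop_ext _ _ (fun phi => 0 ** phi)).
  by move=> phi; exact: smul0l.
rewrite -(addbF p); apply: homog_diffop_smul; first exact: homogeneous0.
exact: homog_diffop_id.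
Qed.

Lemma homog_diffop_scale k p (c : R) A :
  homog_diffop k p A -> homog_diffop k p (fun phi => c *: A phi).
Proof.
move=> hA; have := homog_diffop_lin c hA (homog_diffop_zero k p).
by apply: homog_diffop_ext => phi; rewrite addr0.
Qed.

Lemma homog_diffop_add k p A B : homog_diffop k p A -> homog_diffop k p B ->
  homog_diffop k p (fun phi => A phi + B phi).
Proof.
move=> hA hB; have := homog_diffop_lin 1 hA hB.
by apply: homog_diffop_ext => phi; rewrite scale1r.
Qed.

Lemma homog_diffop_sum k p (T : Type) (r : seq T) (P : pred T)
    (A : T -> superfun -> superfun) :
  (forall t, P t -> homog_diffop k p (A t)) ->
  homog_diffop k p (fun phi => \sum_(t <- r | P t) A t phi).
Proof.
move=> hA; elim: r => [|t r IH].
  apply: homog_diffop_ext (homog_diffop_zero k p) => phi.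
  by rewrite big_nil.
have [Pt|Pt] := boolP (P t).
  have := homog_diffop_add (hA t Pt) IH.
  by apply: homog_diffop_ext => phi; rewrite big_cons Pt.
by apply: homog_diffop_ext IH => phi; rewrite big_cons (negPf Pt).
Qed.

Lemma homog_diffopS k p A : homog_diffop k p A -> homog_diffop k.+1 p A.
Proof.
elim=> {k p A} [k|k p c A B _ hA _ hB|k p q f A hf _ hA|k p i A _ hA].
- exact: homog_diffop_id.
- exact: homog_diffop_lin.
- exact: homog_diffop_smul.
- exact: homog_diffop_etabar.
Qed.

Lemma homog_diffopW k m p A :
  (k <= m)%N -> homog_diffop k p A -> homog_diffop m p A.
Proof.
by move=> /subnK <- hA; elim: (m - k)%N => // d; exact: homog_diffopS.
Qed.

Lemma homog_diffop_linear k p A : homog_diffop k p A -> linear A.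
Proof.
elim=> {k p A} [//|k p c A B _ hA _ hB|k p q f A _ _ hA|k p i A _ hA] d F G.
- rewrite hA hB !scalerDr !scalerA [c * d]mulrC -!addrA; congr (_ + _).
  by rewrite addrCA.
- by rewrite hA smulDr smulZr.
- by rewrite hA etabarD etabarZ.
Qed.

Lemma homog_diffop_homogeneous k p A q phi :
  homog_diffop k p A -> homogeneous q phi -> homogeneous (p (+) q) (A phi).
Proof.
move=> hA hphi; elim: hA => {k p A} [//|k p c A B _ hA _ hB
  |k p q' f A hf _ hA|k p i A _ hA].
- exact/homogeneousD/hB/homogeneousZ.
- by rewrite -addbA; exact: homogeneousM.
- by rewrite addNb; exact: homogeneous_etabar.
Qed.

Lemma homog_diffop_comp_smul k p A q f : homog_diffop k p A ->
  homogeneous q f -> homog_diffop k (q (+) p) (fun phi => A (f ** phi)).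
Proof.
move=> hA hf; elim: hA => {k p A} [k|k p c A B _ hA _ hB
  |k p q' g A hg _ hA|k p i A _ hA].
- exact/homog_diffop_smul/homog_diffop_id.
- exact: homog_diffop_lin.
- by rewrite addbCA; exact: homog_diffop_smul.
- by rewrite addbN; exact: homog_diffop_etabar.
Qed.

Lemma homog_diffop_comp_etabar k p A i : homog_diffop k p A ->
  homog_diffop k.+1 (~~ p) (fun phi => A (etabar i phi)).
Proof.
move=> hA; elim: hA => {k p A} [k|k p c A B _ hA _ hB
  |k p q' g A hg _ hA|k p j A _ hA].
- exact/homog_diffop_etabar/homog_diffop_id.
- exact: homog_diffop_lin.
- by rewrite -addbN; exact: homog_diffop_smul.
- exact: homog_diffop_etabar.
Qed.

Definition conjugate_ops p A B := forall b phi, homogeneous b phi ->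
  forall psi, berezin (A phi ** psi) =
              (-1) ^+ (p && b) * berezin (phi ** B psi).

(** Multiplication by [f] is its own conjugate, that of [\overline\eta_i] is
    its opposite, and conjugation reverses products up to sign. *)
Lemma homog_diffop_conjugate k p A : homog_diffop k p A ->
  exists2 B, homog_diffop k p B & conjugate_ops p A B.
Proof.
elim=> {k p A} [k|k p c A A' _ [B hB AB] _ [B' hB' AB']
  |k p q f A hf hA [B hB AB]|k p i A hA [B hB AB]].
- exists (fun phi => phi); first exact: homog_diffop_id.
  by move=> b phi _ psi; rewrite expr0 mul1r.
- exists (fun phi => c *: B phi + B' phi); first exact: homog_diffop_lin.
  move=> b phi hphi psi; rewrite smulDl smulZl smulDr smulZr.
  by rewrite !berezinP (AB _ _ hphi) (AB' _ _ hphi) mulrDr mulrCA.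
- exists (fun phi => (-1) ^+ (q && p) *: B (f ** phi)).
    exact/homog_diffop_scale/homog_diffop_comp_smul.
  move=> b phi hphi psi.
  rewrite (smulC hf (homog_diffop_homogeneous hA hphi)) smulZl -smulA linearZ/=.
  rewrite (AB _ _ hphi) smulZr linearZ/= !mulrA -!signr_addb.
  by congr ((-1) ^+ nat_of_bool _ * _); case: (q); case: (p); case: (b).
- exists (fun phi => (- (-1) ^+ p) *: B (etabar i phi)).
    exact/homog_diffop_scale/homog_diffop_comp_etabar.
  move=> b phi hphi psi.
  rewrite (berezin_etabar_adj _ _ (homog_diffop_homogeneous hA hphi)).
  rewrite (AB _ _ hphi) smulZr linearZ/= !mulNr mulrN !mulrA -!signr_addb.
  by congr (- ((-1) ^+ nat_of_bool _ * _)); case: (p); case: (b).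
Qed.

(** The action of [X_F] on an operator [A] of parity [p], for [F] of parity
    [q]. *)
Definition lie_bracket lambda mu q F p A phi :=
  lie mu F (A phi) - (-1) ^+ (p && q) *: A (lie lambda F phi).

(** The bracket is a superderivation of composition, so it suffices that the
    brackets with the generators do not raise the order: this is [lie_smul] for
    functions and [lie_etabar] for the [\overline\eta_i]. *)
Lemma homog_diffop_lie_bracket lambda mu q F k p A :
  homogeneous q F -> homog_diffop k p A ->
  homog_diffop k (q (+) p) (lie_bracket lambda mu q F p A).
Proof.
move=> hF; elim=> {k p A} [k|k p c A B _ hA _ hB
  |k p q' f A hf hA0 hA|k p i A hA0 hA].
- apply: (@homog_diffop_ext _ _ (fun phi => ((mu - lambda) *: dx F) ** phi)).
    move=> phi; rewrite /lie_bracket/= expr0 scale1r smulZl scalerBl.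
    by rewrite /lie /lie_density [in RHS]opprD addrACA subrr add0r.
  apply: homog_diffop_smul; last exact: homog_diffop_id.
  exact/homogeneousZ/homogeneous_dx.
- have := homog_diffop_lin c hA hB; apply: homog_diffop_ext => phi.
  have lieP (X Y : superfun) : lie mu F (c *: X + Y) = c *: lie mu F X + lie mu F Y.
    exact: linearP.
  rewrite /lie_bracket lieP.
  move: (lie mu F _) (lie mu F _) (A (lie _ _ _)) (B (lie _ _ _)) => X Y Z W.
  rewrite scalerBr scalerDr opprD addrACA.
  by rewrite !scalerA [c * _]mulrC.
- have hA1 := homog_diffop_smul (homogeneous_contact hF hf) hA0.
  have hA2 := homog_diffop_scale ((-1) ^+ (q && q')) (homog_diffop_smul hf hA).
  rewrite -addbA in hA1; rewrite addbCA in hA2.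
  apply: homog_diffop_ext (homog_diffop_add hA1 hA2) => phi.
  rewrite /lie_bracket (lie_smul _ _ hF hf) (smulBr f).
  rewrite (smulZr _ f).
  move: (contact_field F f ** _) (f ** lie _ _ _) (f ** A _) => X Y Z.
  rewrite scalerBr addrA; congr (_ + _ - _).
  rewrite scalerA -signr_addb; congr (_ *: _).
  by congr ((-1) ^+ nat_of_bool _); case: (q); case: (p); case: (q').
- have hA1 := homog_diffop_scale ((-1) ^+ q) (homog_diffop_etabar i hA).
  have hA2 := homog_diffop_scale 2^-1 (@homog_diffop_sum _ _ _ (index_enum 'I_n)
    xpredT _ (fun j _ => homog_diffop_smul
      (homogeneous_etabar i (homogeneous_etabar j hF))
      (homog_diffop_etabar j hA0))).
  have hA3 := homog_diffop_scale (- (mu * (-1) ^+ q))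
    (homog_diffop_smul (homogeneous_etabar i (homogeneous_dx hF))
      (homog_diffopS hA0)).
  rewrite -addbN in hA1; rewrite negbK in hA2; rewrite addNb -addbN in hA3.
  apply: homog_diffop_ext (homog_diffop_add (homog_diffop_add hA1 hA2) hA3) =>
    phi.
  rewrite /lie_bracket (lie_etabar _ _ _ hF) etabarB etabarZ.
  rewrite scalerBr scalerA -signr_addb scaleNr.
  have -> : q (+) (p && q) = ~~ p && q by case: (q); case: (p).
  move: (_ *: etabar i (lie _ _ _)) (_ *: etabar i (A _)) (2^-1 *: _).
  move: (_ *: (etabar _ _ ** _)) => Z X Y W.
  by apply/ffunP => K; rewrite !ffunE; ring.
Qed.

End HomogeneousOperators.

(** * Ordered monomials *)

Section DifferentialOperators.
Variables (R : realType) (n : nat).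
Local Notation superfun := (superfun R n).
Implicit Types (F G H : superfun) (i j : 'I_n) (I J K : {set 'I_n}).
Implicit Types (p q : bool).

Local Notation "F ** G" := (smul F G) (at level 40, left associativity).
Implicit Types (k : nat) (A B : superfun -> superfun).

Lemma iter_etabar_anti i j m F : i != j ->
  etabar i (iter m (etabar j) F) = (-1) ^+ m *: iter m (etabar j) (etabar i F).
Proof.
move=> ij; elim: m => [|m IH]; first by rewrite scale1r.
rewrite /= etabar_comm (negPf ij) mulr0 scale0r subr0 IH etabarZ.
by rewrite exprS mulN1r scaleNr.
Qed.

Definition incr_index (l : 'I_n -> nat) i : 'I_n -> nat := fun j =>
  (l j + (i == j))%N.

(** Moving [\overline\eta_i] to its place in the ordered monomial only costs a
    sign. *)
Lemma etabar_etabar_pow i (l : 'I_n -> nat) : exists m, forall F,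
  etabar i (etabar_pow l F) = (-1) ^+ m *: etabar_pow (incr_index l i) F.
Proof.
rewrite /etabar_pow; have := mem_enum 'I_n i; have := enum_uniq 'I_n.
elim: (enum 'I_n) => [//|a s IH] /= /andP[a_s us].
rewrite /incr_index inE; have [ia _|ia /= /(IH us)[m mE]] := eqVneq i a.
  exists 0%N => F; rewrite scale1r -{}ia in a_s *; rewrite addn1/=.
  congr (etabar i (iter _ _ _)).
  elim: s a_s {us IH} => [//|b s IH]; rewrite inE negb_or => /andP[ib i_s] /=.
  by rewrite IH// (negPf ib) addn0.
exists (l a + m)%N => F; rewrite (iter_etabar_anti _ _ ia) mE addn0.
rewrite exprD -scalerA; congr (_ *: _).
by elim: (l a) => //= d ->; rewrite etabarZ.
Qed.

Lemma homog_diffop_etabar_pow (l : 'I_n -> nat) :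
  homog_diffop (\sum_i l i) (odd (\sum_i l i)) (@etabar_pow R n l).
Proof.
rewrite -big_enum/= /etabar_pow; elim: (enum 'I_n) => [|a s IH].
  by rewrite big_nil; exact: homog_diffop_id.
rewrite big_cons /=; elim: (l a) => [//|m]; exact: homog_diffop_etabar.
Qed.

Definition superone : superfun := [ffun I : {set 'I_n} => (I == set0)%:R].

Lemma smul1l F : superone ** F = F.
Proof.
apply/ffunP => K; rewrite ffunE (bigD1 set0) ?sub0set//= big1 ?addr0.
  by rewrite ninv0l setD0 ffunE eqxx !mul1r.
by move=> I /andP[_ /negPf I0]; rewrite ffunE I0 mulr0 mul0r.
Qed.

Section Representation.
Variables lambda mu : R.

(** Typed on plain superfunctions, for which [homog_diffop] is stated. *)
Definition diffop_le k A := @is_diffop R n lambda mu k A.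

Lemma diffop_le_linear k A : diffop_le k A -> linear A.
Proof.
move=> [a Aa] c F G; rewrite !Aa scaler_sumr -big_split; apply: eq_bigr => l _.
by rewrite (homog_diffop_linear (homog_diffop_etabar_pow _)) smulDr smulZr.
Qed.

Lemma diffop_le_lin k (c : R) A B : diffop_le k A -> diffop_le k B ->
  diffop_le k (fun phi => c *: A phi + B phi).
Proof.
move=> [a aE] [b bE]; exists (fun l => c *: a l + b l) => phi.
rewrite aE bE scaler_sumr -big_split; apply: eq_bigr => l _ /=.
by rewrite smulDl smulZl.
Qed.

Lemma diffop_le_sum k (T : Type) (r : seq T) (P : pred T)
    (A : T -> superfun -> superfun) :
  (forall t, P t -> diffop_le k (A t)) ->
  diffop_le k (fun phi => \sum_(t <- r | P t) A t phi).
Proof.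
move=> hA; elim: r => [|t r IH].
  exists (fun=> 0) => phi; rewrite big_nil big1// => l _; exact: smul0l.
have [Pt|Pt] := boolP (P t).
  have [a aE] := diffop_le_lin 1 (hA t Pt) IH.
  by exists a => phi; rewrite big_cons Pt -aE scale1r.
by have [a aE] := IH; exists a => phi; rewrite big_cons (negPf Pt) -aE.
Qed.

Lemma diffop_le_monomial k (l : 'I_n -> nat) f : (\sum_i l i <= k)%N ->
  diffop_le k (fun phi => f ** etabar_pow l phi).
Proof.
move=> lk; have lk' i : (l i < k.+1)%N.
  by rewrite ltnS (leq_trans _ lk)// (bigD1 i)//= leq_addr.
pose l' : {ffun 'I_n -> 'I_k.+1} := [ffun i => Ordinal (lk' i)].
have l'E : (fun i => l' i : nat) = l by apply/funext => i; rewrite ffunE.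
exists (fun m => if m == l' then f else 0) => phi.
rewrite (bigD1 l')/=; last by rewrite (eq_bigr l)// => i _; rewrite ffunE.
rewrite eqxx l'E big1 ?addr0// => m /andP[_ /negPf ->]; exact: smul0l.
Qed.

(** Composing an ordered sum with [\overline\eta_i] on the left gives, by the
    Leibniz rule and [etabar_etabar_pow], a sum of ordered monomials whose
    length has grown by at most one. *)
Lemma homog_diffop_le k p A : homog_diffop k p A -> diffop_le k A.
Proof.
elim=> {k p A} [k|k p c A B _ hA _ hB|k p q f A _ _ [a aE]|k p i A _ [a aE]].
- have [|a aE] := @diffop_le_monomial k (fun=> 0%N) superone.
    by rewrite big1.
  exists a => phi; rewrite -aE smul1l /etabar_pow.
  by elim: (enum 'I_n).
- exact: diffop_le_lin.
- exists (fun l => f ** a l) => phi; rewrite aE smul_sumr.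
  by apply: eq_bigr => l _; rewrite smulA.
- suff : diffop_le k.+1 (fun phi => \sum_(l : {ffun 'I_n -> 'I_k.+1} |
      (\sum_i l i <= k)%N) etabar i (a l ** etabar_pow (fun j =>
        l j : nat) phi)).
    by move=> [b bE]; exists b => phi; rewrite aE etabar_sum -bE.
  apply: diffop_le_sum => l lk.
  have [m mE] := etabar_etabar_pow i (fun j => l j : nat).
  have h1 := diffop_le_monomial (etabar i (a l)) (leqW lk).
  have lk1 : (\sum_j incr_index (fun j => l j : nat) i j <= k.+1)%N.
    rewrite big_split/= [X in (_ + X)%N](bigD1 i)//= eqxx.
    rewrite [X in (_ + (_ + X))%N]big1; last first.
      by move=> j /negPf; rewrite eq_sym => ->.
    by rewrite addn0 addn1 ltnS.
  have h2 (q : bool) := diffop_le_monomial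
    ((-1) ^+ q *: ((-1) ^+ m *: part q (a l))) lk1.
  have [b bE] := diffop_le_lin 1 h1 (@diffop_le_sum k.+1 bool (index_enum bool)
    xpredT _ (fun q _ => h2 q)).
  exists b => phi; rewrite -bE scale1r.
  have -> : etabar i (a l) = \sum_q etabar i (part q (a l)).
    by rewrite -etabar_sum sum_part.
  rewrite -{1}(sum_part (a l)) !smul_suml etabar_sum -big_split.
  apply: eq_bigr => q _ /=.
  rewrite (etabarM _ _ (homogeneous_part q _)) mE smulZr.
  by rewrite !smulZl.
Qed.

(** The parity of a term is that of its coefficient plus that of its monomial,
    so splitting the coefficients by parity splits the operator. *)
Lemma diffop_le_split k A : diffop_le k A ->
  exists2 A_ : bool -> superfun -> superfun,
    forall p, homog_diffop k p (A_ p) & forall phi, A phi = \sum_p A_ p phi.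
Proof.
move=> [a aE].
exists (fun p phi => \sum_(l : {ffun 'I_n -> 'I_k.+1} | (\sum_i l i <= k)%N)
  part (p (+) odd (\sum_i l i)%N) (a l) ** etabar_pow (fun i => l i : nat) phi).
  move=> p; apply: homog_diffop_sum => l lk.
  rewrite -[p in homog_diffop _ p](addbK (odd (\sum_i l i)%N)).
  apply: homog_diffop_smul; first exact: homogeneous_part.
  exact/(homog_diffopW lk)/homog_diffop_etabar_pow.
move=> phi; rewrite aE exchange_big; apply: eq_bigr => l _ /=.
rewrite -smul_suml -{1}(sum_part (a l)); congr (_ ** _).
by rewrite !big_bool/=; case: (odd _); rewrite //= addrC.
Qed.

End Representation.

End DifferentialOperators.

(** * Conjugate operators *)

Section Conjugation.
Variables (R : realType) (n : nat).
Local Notation superfun := (superfun R n).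
Implicit Types (F G H : superfun) (i j : 'I_n) (I J K : {set 'I_n}).
Implicit Types (p q : bool).

Local Notation "F ** G" := (smul F G) (at level 40, left associativity).
Implicit Types (k : nat) (b d : bool) (A B : superfun -> superfun).
Implicit Types (phi psi X Y : superfun).

(** In a nonzero pairing of [A phi] with [psi] the parities of the
    homogeneous component of [A] involved, of [phi] and of [psi] add up to that
    of [n]. Hence the sign of the conjugation formula depends on [phi] and
    [psi] only, and the formula makes sense for inhomogeneous [A]. *)
Definition conjugate_pair A B := forall b d phi psi,
  homogeneous b phi -> homogeneous d psi ->
  berezin (A phi ** psi) =
  (-1) ^+ ((odd n (+) b (+) d) && b) * berezin (phi ** B psi).

Lemma berezin_part_l q d X psi : homogeneous d psi ->
  berezin (part q X ** psi) = if q == odd n (+) d then berezin (X ** psi) else 0.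
Proof.
move=> hpsi; have P r : r != odd n (+) d -> berezin (part r X ** psi) = 0.
  move=> rn; apply: (berezin_parity (homogeneousM (homogeneous_part r X) hpsi)).
  by apply: contra rn => /eqP <-; rewrite addbK.
case: eqP => [qE|/eqP /P //].
rewrite -[in RHS](sum_part X) smul_suml linear_sum (bigD1 q)//= big1 ?addr0//.
by move=> r; rewrite qE; exact: P.
Qed.

Lemma berezin_part_r q b phi X : homogeneous b phi ->
  berezin (phi ** part q X) = if q == odd n (+) b then berezin (phi ** X) else 0.
Proof.
move=> hphi; have P r : r != odd n (+) b -> berezin (phi ** part r X) = 0.
  move=> rn; apply: (berezin_parity (homogeneousM hphi (homogeneous_part r X))).
  by apply: contra rn => /eqP <-; rewrite [b (+) r]addbC addbK.
case: eqP => [qE|/eqP /P //].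
rewrite -[in RHS](sum_part X) smul_sumr linear_sum (bigD1 q)//= big1 ?addr0//.
by move=> r; rewrite qE; exact: P.
Qed.

(** Only the component of [X] of parity [odd n (+) b] contributes to either
    side, so [X] may be taken homogeneous. *)
Lemma berezin_comm b phi X : homogeneous b phi ->
  berezin (phi ** X) = (-1) ^+ (b && (odd n (+) b)) * berezin (X ** phi).
Proof.
move=> hphi; set q := odd n (+) b.
have <- : berezin (phi ** part q X) = berezin (phi ** X).
  by rewrite (berezin_part_r _ _ hphi) eqxx.
have <- : berezin (part q X ** phi) = berezin (X ** phi).
  by rewrite (berezin_part_l _ _ hphi) eqxx.
by rewrite (smulC hphi (homogeneous_part q X)) linearZ.
Qed.

(** Supercommutativity exchanges the two factors of each pairing; the signs that
    this costs and that of the formula multiply to the one required. *)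
Lemma conjugate_pair_sym A B : conjugate_pair A B -> conjugate_pair B A.
Proof.
move=> AB d b psi phi hpsi hphi.
rewrite (berezin_comm (A phi) hpsi) (AB _ _ _ _ hphi hpsi).
rewrite (berezin_comm (B psi) hphi) !mulrA -!signr_addb.
by case: (odd n); case: b {hphi}; case: d {hpsi}; rewrite expr0 mul1r.
Qed.

Lemma conjugate_pair_unique A B B' : linear B -> linear B' ->
  conjugate_pair A B -> conjugate_pair A B' -> B =1 B'.
Proof.
move=> lB lB' AB AB' psi.
have BE d X : homogeneous d X -> B X = B' X.
  move=> hX; apply/eqP; rewrite -subr_eq0; apply/eqP.
  apply: berezin_nondegenerate => b phi hphi; rewrite smulBr linearB/=.
  apply/eqP; rewrite subr_eq0; apply/eqP.
  apply: (can_inj (signrMK ((odd n (+) b (+) d) && b))).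
  by rewrite -(AB _ _ _ _ hphi hX) -(AB' _ _ _ _ hphi hX).
rewrite -(sum_part psi) big_bool/= -[part true psi]scale1r lB lB'.
rewrite (BE _ _ (homogeneous_part true psi)).
by rewrite (BE _ _ (homogeneous_part false psi)).
Qed.

Lemma conjugate_pair_lin (c : R) A A' B B' :
  conjugate_pair A B -> conjugate_pair A' B' ->
  conjugate_pair (fun phi => c *: A phi + A' phi) (fun psi =>
    c *: B psi + B' psi).
Proof.
move=> AB AB' b d phi psi hphi hpsi; rewrite smulDl smulZl smulDr smulZr.
rewrite !berezinP (AB _ _ _ _ hphi hpsi) (AB' _ _ _ _ hphi hpsi).
by rewrite mulrDr mulrCA.
Qed.

Lemma conjugate_pair_sum (T : Type) (r : seq T) (P : pred T)
    (A B : T -> superfun -> superfun) :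
  (forall t, P t -> conjugate_pair (A t) (B t)) ->
  conjugate_pair (fun phi => \sum_(t <- r | P t) A t phi)
                 (fun psi => \sum_(t <- r | P t) B t psi).
Proof.
move=> AB b d phi psi hphi hpsi; rewrite smul_suml smul_sumr !linear_sum/=.
rewrite mulr_sumr; apply: eq_bigr => t Pt; exact: AB.
Qed.

(** Where the two signs differ, both pairings vanish for reasons of parity. *)
Lemma conjugate_opsP p A B : linear B ->
  (forall q phi, homogeneous q phi -> homogeneous (p (+) q) (A phi)) ->
  conjugate_ops p A B <-> conjugate_pair A B.
Proof.
move=> lB hA; have A0 b d phi psi : homogeneous b phi -> homogeneous d psi ->
    p != odd n (+) b (+) d -> berezin (A phi ** psi) = 0.
  move=> hphi hpsi pn; apply: (berezin_parity (homogeneousM (hA _ _ hphi) hpsi)).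
  by apply: contra pn => /eqP <-; case: (p); case: (b); case: (d).
split=> AB b.
  move=> d phi psi hphi hpsi; have := AB _ _ hphi psi.
  have [->//|pn] := eqVneq p (odd n (+) b (+) d).
  rewrite (A0 _ _ _ _ hphi hpsi pn) => /esym/eqP.
  by rewrite mulf_eq0 signr_eq0/= => /eqP ->; rewrite mulr0.
move=> phi hphi psi.
have E d X : homogeneous d X ->
    berezin (A phi ** X) = (-1) ^+ (p && b) * berezin (phi ** B X).
  move=> hX; have := AB _ _ _ _ hphi hX.
  have [->//|pn] := eqVneq p (odd n (+) b (+) d).
  rewrite (A0 _ _ _ _ hphi hX pn) => /esym/eqP.
  by rewrite mulf_eq0 signr_eq0/= => /eqP ->; rewrite mulr0.
rewrite -(sum_part psi) big_bool/= -[part true psi]scale1r lB !smulDr !smulZr.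
rewrite !berezinP mulrDr mulrCA; congr (_ * _ + _); apply: E;
  exact: homogeneous_part.
Qed.

Section Weights.
Variables lambda mu : R.
Local Notation w := (berezin_weight R n).

Lemma op_part_split k q (A_ : bool -> superfun -> superfun)
    (A : density n lambda -> density n mu) :
  (forall p, homog_diffop k p (A_ p)) -> (forall phi, A phi = \sum_p A_ p phi) ->
  op_part q A = A_ q.
Proof.
move=> hA AE; have lA p : linear (A_ p) by exact: homog_diffop_linear (hA p).
apply/funext => phi; rewrite /op_part.
have E r : part (q (+) r) (A (part r phi)) = A_ q (part r phi).
  rewrite AE linear_sum (bigD1 q)//= big1 ?addr0 => [|p pq].
    exact/(homog_diffop_homogeneous (hA q))/homogeneous_part.
  have := homog_diffop_homogeneous (hA p) (homogeneous_part r phi).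
  by move=> /part_neq0; apply; apply: contra pq => /eqP/addIb ->.
rewrite big_bool/= !E -[X in X + _]scale1r -lA scale1r.
by have := sum_part phi; rewrite big_bool/= => ->.
Qed.

Lemma homog_diffop_op_part k q (A : density n lambda -> density n mu) :
  is_diffop k A -> homog_diffop k q (op_part q A).
Proof. by move=> /diffop_le_split[A_ hA AE];
  rewrite (op_part_split q hA AE). Qed.

Lemma is_diffop_lie_op k F (A : density n lambda -> density n mu) :
  is_diffop k A -> is_diffop k (lie_op F A).
Proof.
move=> dA; apply: diffop_le_sum => p _; apply: diffop_le_sum => q _.
apply: (@homog_diffop_le _ _ _ _ _ (p (+) q)).
exact/homog_diffop_lie_bracket/homog_diffop_op_part/dA/homogeneous_part.
Qed.

Lemma conjugate_pair_exists k (A : density n lambda -> density n mu) :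
  is_diffop k A -> exists2 B : density n (w - mu) -> density n (w - lambda),
    is_diffop k B & conjugate_pair A B.
Proof.
move=> /diffop_le_split[A_ hA AE].
have /choice[B_ hB] p : exists B,
    homog_diffop k p B /\ conjugate_ops p (A_ p) B.
  by have [B hB AB] := homog_diffop_conjugate (hA p); exists B.
exists (fun psi => \sum_p B_ p psi).
  by apply: diffop_le_sum => p _; apply: homog_diffop_le (hB p).1.
have -> : A = fun phi => \sum_p A_ p phi by exact/funext.
apply: conjugate_pair_sum => p _; apply/(@conjugate_opsP p);
  last exact: (hB p).2.
  exact: homog_diffop_linear (hB p).1.
by move=> q phi; exact: homog_diffop_homogeneous (hA p).
Qed.

Lemma conjugate_pair_op_part q (A : density n lambda -> density n mu)
    (B : density n (w - mu) -> density n (w - lambda)) :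
  linear (A : superfun -> superfun) -> linear (B : superfun -> superfun) ->
  conjugate_pair A B -> conjugate_pair (op_part q A) (op_part q B).
Proof.
have E lam lam' (C : density n lam -> density n lam') r phi :
    linear (C : superfun -> superfun) -> homogeneous r phi ->
    op_part q C phi = part (q (+) r) (C phi).
  move=> lC hphi; have C0 : C 0 = 0.
    by have := lC (-1) 0 0; rewrite scaler0 addr0 scaleN1r addNr.
  rewrite /op_part (bigD1 r)//= hphi big1 ?addr0// => s sr.
  by rewrite (part_neq0 hphi) 1?eq_sym// C0 linear0.
move=> lA lB AB b d phi psi hphi hpsi.
rewrite (E _ _ A _ _ lA hphi) (E _ _ B _ _ lB hpsi).
rewrite (berezin_part_l _ _ hpsi) (berezin_part_r _ _ hphi).
have -> : (q (+) d == odd n (+) b) = (q (+) b == odd n (+) d).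
  by case: (q); case: (odd n); case: (b); case: (d).
case: ifP => _; first exact: AB.
by rewrite mulr0.
Qed.

(** Conjugation reverses the two products in the bracket, and [L_F] is skew, so
    they are exchanged with the sign that the bracket requires. *)
Lemma conjugate_ops_lie_bracket p q F A B : homogeneous p F ->
  (forall r phi, homogeneous r phi -> homogeneous (q (+) r) (A phi)) ->
  conjugate_ops q A B ->
  conjugate_ops (p (+) q) (lie_bracket lambda mu p F q A)
                          (lie_bracket (w - mu) (w - lambda) p F q B).
Proof.
move=> hF hA AB b phi hphi psi; rewrite /lie_bracket.
rewrite smulDl smulNl smulZl smulBr smulZr !linearB/= !linearZ/=.
rewrite (berezin_lie _ _ hF (hA _ _ hphi)) (AB _ _ hphi).
rewrite (AB _ _ (homogeneous_lie lambda hF hphi)) (berezin_lie _ _ hF hphi).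
rewrite /GRing.scale/=; move: (berezin _) (berezin _) => X Y.
by case: (p); case: (q); case: (b); rewrite /= ?expr0 ?expr1; ring.
Qed.

Lemma conjugate_pair_lie_op k F (A : density n lambda -> density n mu)
    (B : density n (w - mu) -> density n (w - lambda)) :
  is_diffop k A -> is_diffop k B ->
  conjugate_pair A B -> conjugate_pair (lie_op F A) (lie_op F B).
Proof.
move=> dA dB AB; apply: conjugate_pair_sum => p _; apply: conjugate_pair_sum =>
  q _.
have hA := homog_diffop_op_part q dA; have hB := homog_diffop_op_part q dB.
have hF := homogeneous_part p F.
have hLA := homog_diffop_lie_bracket lambda mu hF hA.
have hLB := homog_diffop_lie_bracket (w - mu) (w - lambda) hF hB.
apply/(@conjugate_opsP (p (+) q)).
- exact: homog_diffop_linear hLB.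
- by move=> r phi; exact: homog_diffop_homogeneous hLA.
apply: conjugate_ops_lie_bracket => //.
  by move=> r phi; exact: homog_diffop_homogeneous hA.
apply/conjugate_opsP.
- exact: homog_diffop_linear hB.
- by move=> r phi; exact: homog_diffop_homogeneous hA.
apply: conjugate_pair_op_part AB; first exact: (diffop_le_linear dA).
exact: (diffop_le_linear dB).
Qed.

End Weights.

End Conjugation.

(** * The conjugation map *)

Section ConjugationMap.
Variables (R : realType) (n : nat) (lambda mu : R) (k : nat).
Local Notation w := (berezin_weight R n).

Lemma is_diffop_val lam lam' (A : @diffop R n lam lam' k) : is_diffop k A.
Proof. by case: A => A /= /diffopP. Qed.

Lemma diffop_eq lam lam' (A B : @diffop R n lam lam' k) :
  (forall phi, A phi = B phi) -> A = B.
Proof. by move=> AB; apply/val_inj/funext. Qed.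

Lemma conjugation_exists (A : diffop n lambda mu k) :
  exists B : diffop n (w - mu) (w - lambda) k, conjugate_pair A B.
Proof.
have [B dB AB] := conjugate_pair_exists (is_diffop_val A).
by exists (DiffOp (introT (diffopP _ _) dB)).
Qed.

Definition conjugation (A : diffop n lambda mu k) :
    diffop n (w - mu) (w - lambda) k := sval (cid (conjugation_exists A)).

Lemma conjugationP (A : diffop n lambda mu k)
    (B : diffop n (w - mu) (w - lambda) k) :
  conjugate_pair A B <-> B = conjugation A.
Proof.
rewrite /conjugation; case: cid => /= B' AB'; split=> [AB|-> //].
apply: diffop_eq => psi; apply: conjugate_pair_unique AB AB' psi.
  exact: (diffop_le_linear (is_diffop_val B)).
exact: (diffop_le_linear (is_diffop_val B')).
Qed.

Lemma conjugation_pair (A : diffop n lambda mu k) :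
  conjugate_pair A (conjugation A).
Proof. exact/conjugationP. Qed.

Fact conjugation_linear : linear conjugation.
Proof.
move=> c A A'; apply/esym/conjugationP.
exact: conjugate_pair_lin (conjugation_pair A) (conjugation_pair A').
Qed.

HB.instance Definition _ :=
  GRing.isLinear.Build R (diffop n lambda mu k)
    (diffop n (w - mu) (w - lambda) k) *:%R conjugation conjugation_linear.

Lemma conjugateP a (A : diffop n lambda mu k)
    (B : diffop n (w - mu) (w - lambda) k) :
  op_homogeneous a A -> (conjugate a A B <-> B = conjugation A).
Proof.
move=> hA; rewrite -conjugationP; apply: conjugate_opsP => //.
exact: (diffop_le_linear (is_diffop_val B)).
Qed.

Lemma conjugation_invariant : contact_invariant conjugation.
Proof.
move=> F A; have dXA := is_diffop_lie_op F (is_diffop_val A).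
have dXB := is_diffop_lie_op F (is_diffop_val (conjugation A)).
exists (DiffOp (introT (diffopP _ _) dXA)) => //.
suff <- : DiffOp (introT (diffopP _ _) dXB) =
    conjugation (DiffOp (introT (diffopP _ _) dXA)) by [].
apply/conjugationP; apply: conjugate_pair_lie_op (conjugation_pair A).
  exact: is_diffop_val.
exact: is_diffop_val.
Qed.

Lemma conjugation_inj : injective conjugation.
Proof.
move=> A A' AA'; apply: diffop_eq => phi.
have AB := conjugate_pair_sym (conjugation_pair A).
have AB' := conjugate_pair_sym (conjugation_pair A').
rewrite AA' in AB; apply: conjugate_pair_unique AB AB' phi.
  exact: (diffop_le_linear (is_diffop_val A)).
exact: (diffop_le_linear (is_diffop_val A')).
Qed.

(** An antecedent of [B] is a conjugate of [B], as being conjugate is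
    symmetric. The weights of the conjugate of [B] are only provably equal to
    [lambda] and [mu]; being a differential operator does not depend on them
    up to conversion. *)
Lemma conjugation_surj (B : diffop n (w - mu) (w - lambda) k) :
  exists A, conjugation A = B.
Proof.
have [A dA BA] := conjugate_pair_exists (is_diffop_val B).
have dA' : @is_diffop R n lambda mu k A := dA.
exists (DiffOp (introT (diffopP _ _) dA')); apply/esym/conjugationP.
exact: conjugate_pair_sym.
Qed.

Lemma conjugation_bij : bijective conjugation.
Proof.
have [g gK] := choice conjugation_surj.
by exists g => // A; apply: conjugation_inj; rewrite gK.
Qed.

End ConjugationMap.

Theorem corollary9p1 (R : realType) (n : nat) (hn : (2 <= n)%N)
    (lambda mu : R) (k2 : nat) :
  exists star : {linear diffop n lambda mu k2 ->
      diffop n (berezin_weight R n - mu) (berezin_weight R n - lambda) k2},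
    [/\ forall (a : bool) (A : diffop n lambda mu k2)
            (B : diffop n (berezin_weight R n - mu)
                          (berezin_weight R n - lambda) k2),
          op_homogeneous a A -> (conjugate a A B <-> B = star A),
        contact_invariant star
      & bijective star].
Proof.
exists (@conjugation R n lambda mu k2); split.
- exact: conjugateP.
- exact: conjugation_invariant.
- exact: conjugation_bij.
Qed.
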